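(* Let $\beta\in\{1,2,4\}$ and $\alpha>0$. The exceptional hyperbolic ensemble on $\mathbb{H}_{2,\beta}$ with parameter $\alpha$ is a Meixner ensemble with parameters $$A=\frac1{1+2\alpha},\quad B=0,\quad C=\frac{4\alpha^2}{2\alpha+1}.$$ For $\mathbf X$ with this law, the mean and the variance are $\mathbb{E}(\mathbf X)=\mathbf 0$ and $\mathrm{Var}(\mathbf X)=\alpha\mathbf I_2$. For the standardized version $\widetilde{\mathbf X}$ of $\mathbf X$ (with $\widetilde{\mathbf Y}$ an independent copy and $\widetilde{\mathbf S}=\widetilde{\mathbf X}+\widetilde{\mathbf Y}$), $$\mathbb{E}\big((\widetilde{\mathbf X}-\widetilde{\mathbf Y})^2\big|\widetilde{\mathbf S}\big)=\frac2{1+2a}\left(\mathbf I_2+b\widetilde{\mathbf S}+a\widetilde{\mathbf S}^2\right)$$ holds with $a=\frac1{4\alpha}$ and $b=0$.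
   Context: For $\beta=1,2,4$, $\mathbb{H}_{2,\beta}$ is the real vector space of $2\times2$ real symmetric, complex Hermitian, respectively quaternionic Hermitian matrices. A law $\mu$ on $\mathbb{H}_{2,\beta}$ is rotation invariant if $U\mathbf XU^*\sim\mathbf X$ for all $U$ in $O(2)$, $U(2)$, $Sp(2)$ (quaternionic unitary matrices) respectively when $\mathbf X\sim\mu$. $\mu$ is a Meixner ensemble with parameters $A,B,C\in\mathbb R$ if it is rotation invariant, has finite second moments, and for $\mathbf X,\mathbf Y$ independent with law $\mu$ and $\mathbf S=\mathbf X+\mathbf Y$ one has $\mathbb{E}((\mathbf X-\mathbf Y)^2|\mathbf S)=A\mathbf S^2+B\mathbf S+C\mathbf I_2$. $\mathrm{Var}(\mathbf X)=\mathbb{E}(\mathbf X^2)-(\mathbb{E}\mathbf X)^2$; if $\mathbb{E}\mathbf X=m\mathbf I_2$ and $\mathrm{Var}(\mathbf X)=s^2\mathbf I_2$ with $s>0$, the standardized version is $\widetilde{\mathbf X}=(\mathbf X-m\mathbf I_2)/s$. Let $\mathcal J_\nu(x)=\Gamma(\nu+1)(2/x)^\nu J_\nu(x)$, with $J_\nu$ the Bessel function of the first kind. For every $\alpha>0$ there is a unique probability measure $\mu_\alpha$ on $\mathbb R^{\beta+1}$ such that $\int e^{\langle\mathbf t,\mathbf y\rangle}\mu_\alpha(d\mathbf y)=\big(\mathcal J_{(\beta-1)/2}(\|\mathbf t\|)\big)^{-\alpha}$ for all $\mathbf t\in\mathbb R^{\beta+1}$ small enough. Let $(\xi_1,\dots,\xi_{\beta+1})\sim\mu_\alpha$.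 The exceptional hyperbolic ensemble with parameter $\alpha$ is the law of the Hermitian matrix $\mathbf X$ with diagonal entries $\xi_1,-\xi_1$ and upper off-diagonal entry $\xi_2$ ($\beta=1$), $\xi_2+i\xi_3$ ($\beta=2$), $\xi_2+i\xi_3+j\xi_4+k\xi_5$ ($\beta=4$, with $i,j,k$ the standard quaternion units). *)

(* Defs.v *)
From HB Require Import structures.
From mathcomp Require Import all_boot all_order all_algebra.
From mathcomp Require Import ring.
From mathcomp Require Import all_classical all_reals all_analysis.

Set Implicit Arguments.
Unset Strict Implicit.
Unset Printing Implicit Defensive.

Import Order.TTheory GRing.Theory Num.Theory.
Import numFieldNormedType.Exports.

Local Open Scope classical_set_scope.
Local Open Scope ring_scope.

(* The quaternion re + im_i i + im_j j + im_k k. *)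
Record quat (R : realType) : Type :=
  Quat { re : R ; im_i : R ; im_j : R ; im_k : R }.

Section quat_ring.
Variable R : realType.
Implicit Types p q r : quat R.

Definition quat_to_prod q : R * R * R * R := (re q, im_i q, im_j q, im_k q).

Definition prod_to_quat (u : R * R * R * R) : quat R :=
  Quat u.1.1.1 u.1.1.2 u.1.2 u.2.

Lemma quat_to_prodK : cancel quat_to_prod prod_to_quat.
Proof. by case. Qed.

HB.instance Definition _ :=
  Choice.copy (quat R) (can_type quat_to_prodK).

Definition add_quat p q :=
  Quat (re p + re q) (im_i p + im_i q) (im_j p + im_j q) (im_k p + im_k q).

Definition opp_quat p := Quat (- re p) (- im_i p) (- im_j p) (- im_k p).

(* Hamilton's rules i^2 = j^2 = k^2 = ijk = -1 *)
Definition mul_quat p q := Quat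
  (re p * re q - im_i p * im_i q - im_j p * im_j q - im_k p * im_k q)
  (re p * im_i q + im_i p * re q + im_j p * im_k q - im_k p * im_j q)
  (re p * im_j q - im_i p * im_k q + im_j p * re q + im_k p * im_i q)
  (re p * im_k q + im_i p * im_j q - im_j p * im_i q + im_k p * re q).

Definition qreal (a : R) : quat R := Quat a 0 0 0.

Let addqA : associative add_quat.
Proof. by move=> p q r; congr Quat => /=; ring. Qed.
Let addqC : commutative add_quat.
Proof. by move=> p q; congr Quat => /=; ring. Qed.
Let add0q : left_id (qreal 0) add_quat.
Proof. by case=> *; congr Quat => /=; ring. Qed.
Let addNq : left_inverse (qreal 0) opp_quat add_quat.
Proof. by case=> *; congr Quat => /=; ring. Qed.

HB.instance Definition _ :=
  GRing.isZmodule.Build (quat R) addqA addqC add0q addNq.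

Let mulqA : associative mul_quat.
Proof. by move=> p q r; congr Quat => /=; ring. Qed.
Let mul1q : left_id (qreal 1) mul_quat.
Proof. by case=> *; congr Quat => /=; ring. Qed.
Let mulq1 : right_id (qreal 1) mul_quat.
Proof. by case=> *; congr Quat => /=; ring. Qed.
Let mulqDl : left_distributive mul_quat add_quat.
Proof. by move=> p q r; congr Quat => /=; ring. Qed.
Let mulqDr : right_distributive mul_quat add_quat.
Proof. by move=> p q r; congr Quat => /=; ring. Qed.
Let oneq_neq0 : qreal 1 != qreal 0.
Proof. by apply/eqP => -[] /eqP; rewrite oner_eq0. Qed.

HB.instance Definition _ := GRing.Zmodule_isNzRing.Build (quat R)
  mulqA mul1q mulq1 mulqDl mulqDr oneq_neq0.

Definition qconj q : quat R := Quat (re q) (- im_i q) (- im_j q) (- im_k q).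

Definition qcoord (k : 'I_4) q : R :=
  [:: re q; im_i q; im_j q; im_k q]`_k.

End quat_ring.

HB.instance Definition _ (R : realType) := isPointed.Build (quat R) 0.

(* Borel sigma-algebras, generated by the (real) coordinates *)
Definition quat_display : measure_display.
Proof. exact: default_measure_display. Qed.

Definition matrix_display : measure_display -> measure_display.
Proof. exact. Qed.

Section measurable_quat.
Variable R : realType.

Let quat_set0 : g_sigma_preimage (@qcoord R) set0.
Proof. exact: sigma_algebra0. Qed.
Let quat_setC A :
  g_sigma_preimage (@qcoord R) A -> g_sigma_preimage (@qcoord R) (~` A).
Proof. exact: sigma_algebraC. Qed.
Let quat_bigcup (F : (set (quat R))^nat) :
  (forall n, g_sigma_preimage (@qcoord R) (F n)) ->
  g_sigma_preimage (@qcoord R) (\bigcup_n F n).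
Proof. exact: sigma_algebra_bigcup. Qed.

HB.instance Definition _ := @isMeasurable.Build
  quat_display (quat R)
  (g_sigma_preimage (@qcoord R)) quat_set0 quat_setC quat_bigcup.

End measurable_quat.

Section measurable_matrix.
Context {d} {T : measurableType d}.
Variables m n : nat.

Let entry : 'I_(m * n) -> 'M[T]_(m, n) -> T := fun k M => mxvec M ord0 k.

Let matrix_set0 : g_sigma_preimage entry set0.
Proof. exact: sigma_algebra0. Qed.
Let matrix_setC A : g_sigma_preimage entry A -> g_sigma_preimage entry (~` A).
Proof. exact: sigma_algebraC. Qed.
Let matrix_bigcup (F : (set 'M[T]_(m, n))^nat) :
  (forall k, g_sigma_preimage entry (F k)) ->
  g_sigma_preimage entry (\bigcup_k F k).
Proof. exact: sigma_algebra_bigcup. Qed.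

HB.instance Definition _ := @isMeasurable.Build (matrix_display d)
  'M[T]_(m, n) (g_sigma_preimage entry) matrix_set0 matrix_setC matrix_bigcup.

End measurable_matrix.

Section hermitian.
Variable R : realType.

(* R, C and H are realized inside the quaternions: the scalars attached to
   beta = 1, 2, 4 are the quaternions of the form a, a + b i and
   a + b i + c j + d k respectively. *)
Definition scalars (beta : nat) : set (quat R) :=
  [set q | forall k : 'I_4, (beta <= k)%N -> qcoord k q = 0].

Definition adjoint (M : 'M[quat R]_2) : 'M[quat R]_2 := map_mx (@qconj R) M^T.

Definition hermitian (beta : nat) : set 'M[quat R]_2 :=
  [set M : 'M[quat R]_2 | (forall i j, scalars beta (M i j)) /\ adjoint M = M].

(* O(2), U(2), Sp(2) for beta = 1, 2, 4 *)
Definition unitary (beta : nat) : set 'M[quat R]_2 :=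
  [set U : 'M[quat R]_2 | [/\ forall i j, scalars beta (U i j),
               U *m adjoint U = 1%:M & adjoint U *m U = 1%:M]].

Definition mxcoord (i j : 'I_2) (k : 'I_4) (M : 'M[quat R]_2) : R :=
  qcoord k (M i j).

Definition sqmx (M : 'M[quat R]_2) : 'M[quat R]_2 := M *m M.

End hermitian.

Section random_matrices.
Context {R : realType} {d} {T : measurableType d} (P : probability T R).
Implicit Types X Y Z W S : T -> 'M[quat R]_2.

Definition has_law (X : {RV P >-> 'M[quat R]_2})
    (mu : probability 'M[quat R]_2 R) : Prop :=
  forall E, measurable E -> distribution P X E = mu E.

Definition same_law X Y : Prop :=
  forall E, measurable E -> P (X @^-1` E) = P (Y @^-1` E).

Definition independent X Y : Prop :=
  forall E F, measurable E -> measurable F ->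
    P (X @^-1` E `&` Y @^-1` F) = (P (X @^-1` E) * P (Y @^-1` F))%E.

Definition mx_integrable X : Prop :=
  forall i j k, P.-integrable setT (fun w => (mxcoord i j k (X w))%:E).

Definition finite_second_moments X : Prop :=
  forall i j k, P.-integrable setT (fun w => (mxcoord i j k (X w) ^+ 2)%:E).

Definition mx_expectation X : 'M[quat R]_2 :=
  \matrix_(i, j) Quat (fine 'E_P[fun w => re (X w i j)])
                      (fine 'E_P[fun w => im_i (X w i j)])
                      (fine 'E_P[fun w => im_j (X w i j)])
                      (fine 'E_P[fun w => im_k (X w i j)]).

Definition mx_variance X : 'M[quat R]_2 :=
  mx_expectation (fun w => sqmx (X w)) - sqmx (mx_expectation X).

(* W is a version of the conditional expectation of Z given sigma(S). *)
Definition cond_expectation Z S W : Prop :=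
  [/\ mx_integrable Z,
      mx_integrable W,
      measurable_fun [set: g_sigma_algebra_preimageType S] W
    & forall E, measurable E -> forall i j k,
        (\int[P]_(w in S @^-1` E) (mxcoord i j k (Z w))%:E =
         \int[P]_(w in S @^-1` E) (mxcoord i j k (W w))%:E)%E].

Definition standardize (m s : R) X : T -> 'M[quat R]_2 :=
  fun w => qreal s^-1 *: (X w - (qreal m)%:M).

End random_matrices.

Section ensembles.
Variable R : realType.
Implicit Types mu : probability 'M[quat R]_2 R.

Definition rotation_invariant (beta : nat) mu : Prop :=
  forall U, unitary beta U -> forall E, measurable E ->
    mu ((fun M => U *m M *m adjoint U) @^-1` E) = mu E.

(* A law on H_{2,beta} is a law on the 2 x 2 quaternionic matrices that gives
   mass 1 to the hermitian matrices with entries in the scalars of beta. *)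
Definition meixner_ensemble (beta : nat) (A B C : R) mu : Prop :=
  [/\ mu (hermitian beta) = 1%E,
      rotation_invariant beta mu,
      finite_second_moments mu id
    & forall (d : measure_display) (T : measurableType d)
          (P : probability T R) (X Y : {RV P >-> 'M[quat R]_2}),
        has_law X mu -> has_law Y mu -> independent P X Y ->
        let S := fun w => X w + Y w in
        cond_expectation P
          (fun w => sqmx (X w - Y w))
          S
          (fun w => qreal A *: sqmx (S w) + qreal B *: S w + (qreal C)%:M)].

Definition Gamma (x : R) : R :=
  \int[lebesgue_measure]_(t in `]0%R, +oo[) (t `^ (x - 1) * expR (- t)).

(* J_nu(x) for x > 0 *)
Definition besselJ (nu x : R) : R :=
  limn (series (fun n : nat => (-1) ^+ n / (n`!%:R * Gamma (n%:R + nu + 1)) *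
                               (x / 2) `^ (2 * n%:R + nu))).

(* Gamma(nu + 1) (2 / x)^nu J_nu(x), extended by continuity at x = 0; only
   used for x >= 0 *)
Definition normalized_besselJ (nu x : R) : R :=
  if x == 0 then 1 else Gamma (nu + 1) * (2 / x) `^ nu * besselJ nu x.

Definition dot n (t y : n.-tuple R) : R := \sum_(i < n) tnth t i * tnth y i.

Definition norm2 n (t : n.-tuple R) : R := Num.sqrt (dot t t).

(* the defining property of mu_alpha on R^(beta + 1) *)
Definition is_mu_alpha (beta : nat) (alpha : R)
    (mua : probability (beta.+1.-tuple R) R) : Prop :=
  exists2 eps : R, 0 < eps & forall t : beta.+1.-tuple R, norm2 t < eps ->
    (\int[mua]_y (expR (dot t y))%:E =
     (normalized_besselJ ((beta%:R - 1) / 2) (norm2 t) `^ (- alpha))%:E)%E.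

(* As nth returns 0 past the end of a tuple, the off-diagonal entry is
   xi_2, xi_2 + i xi_3 and xi_2 + i xi_3 + j xi_4 + k xi_5 for
   beta = 1, 2 and 4, with xi_k = xi`_(k - 1). *)
Definition hyperbolic_mx (beta : nat) (xi : beta.+1.-tuple R) : 'M[quat R]_2 :=
  let q := Quat xi`_1 xi`_2 xi`_3 xi`_4 in
  \matrix_(i, j)
    if i == 0 then (if j == 0 then qreal xi`_0 else q)
    else (if j == 0 then qconj q else qreal (- xi`_0)).

Definition exceptional_hyperbolic (beta : nat) (alpha : R) mu : Prop :=
  exists2 mua : probability (beta.+1.-tuple R) R,
    is_mu_alpha alpha mua &
    forall E, measurable E -> mu E = mua (@hyperbolic_mx beta @^-1` E).

End ensembles.

(* Main.v *)
(** If X has the exceptional hyperbolic law then X^2 = |xi|^2 I, so everything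
    reduces to identities between expectations of functions of two independent
    copies x, y of xi.  The Laplace transform of xi is L = f^(-alpha), where
    f(t) = J(|t|) satisfies Delta f = - f, the Bessel equation in radial form.
    Hence L Delta L = alpha L^2 + (1 + 1/alpha) |grad L|^2, which says exactly
    that |x - y|^2 and A |x + y|^2 + C have the same Laplace transform against
    exp <t, x + y>.  Since these transforms are finite near 0, they determine
    the conditional expectations; likewise the radial symmetry of L gives the
    rotation invariance of the law. *)
Require Import Defs.
From HB Require Import structures.
From mathcomp Require Import all_boot all_order all_algebra.
From mathcomp Require Import ring lra.
From mathcomp Require Import all_classical all_reals all_analysis.
From mathcomp Require Import measurable_realfun.

Import Order.TTheory GRing.Theory Num.Theory.
Import numFieldNormedType.Exports.

Set Implicit Arguments.
Unset Strict Implicit.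
Unset Printing Implicit Defensive.

Local Open Scope classical_set_scope.
Local Open Scope ring_scope.

(** * Laplace transforms on R^n *)

(** The comparison of [|x - y|^2] with [A |x + y|^2 + C] concerns signed measures whose transforms
    are known only on a small box around 0. Uniqueness is therefore proved for a weight [h] carried
    by a map [psi], and for real arguments only. Derivatives of the transform give all moments, but
    with a small exponential moment a trigonometric series converges under the integral only at low
    frequencies. Multiplying test functions repeatedly replaces analytic continuation: each bounded
    multiplier preserves equality of all moments, so it can be used again without using up the
    exponential moment. Estimates elsewhere do spend part of that moment, on polynomial factors or
    on a change of norm; this is the source of the radii [r / 2], [r / 6] and [r / n.+1]. The
    dimension enters only through [2 (nu + 1) = beta + 1], which makes the Bessel equation of order
    [nu] the equation [Delta f = - f] on R^(beta + 1). *)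

Section derive_under_integral.
Context {R : realType} {d} {T : measurableType d}.
Variable m : {measure set T -> \bar R}.

(** Half of the rate [r0] absorbs [exp (r z)] for [|r| < r0 / 2]. The other half absorbs the factor
    [z] brought down by differentiation, through [|z| <= (2 / r0) exp (r0 |z| / 2)]. *)
Lemma is_derive_Rintegral_expR (w z : T -> R) (r0 : R) : 0 < r0 ->
  measurable_fun [set: T] w -> measurable_fun [set: T] z ->
  m.-integrable [set: T] (fun x => (w x * expR (r0 * `|z x|))%:E) ->
  is_derive (0 : R) 1 (fun r => \int[m]_x (w x * expR (r * z x)))
    (\int[m]_x (w x * z x)).
Proof.
move=> r0_gt0 mw mz iw.
pose f (r : R) x := w x * expR (r * z x).
have df x r : is_derive r (1 : R) (f ^~ x) (w x * z x * expR (r * z x)).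
  have D1 : is_derive r (1 : R) (z x \*: (id : R -> R)) (z x *: 1).
    exact: is_deriveZ.
  have D2 : is_derive r (1 : R) (w x \*: (expR \o (z x \*: (id : R -> R))))
    (w x *: (expR (z x * r) * (z x *: 1))) by apply: is_deriveZ; apply: is_derive1_comp.
  rewrite (_ : f ^~ x = w x \*: (expR \o (z x \*: id))); last first.
    by apply/funext => s; rewrite /f /= [s * _]mulrC.
  by apply: is_derive_eq; rewrite /GRing.scale /= mulr1 [r * _]mulrC; ring.
have d1f r x : partial1of2 f r x = w x * z x * expR (r * z x).
  by rewrite partial1of2E; apply: (@derive_val _ _ _ _ _ _ _ (df x r)).
have mf r : measurable_fun [set: T] (f r).
  apply: measurable_funM => //; apply: measurableT_comp => //.
  exact: measurable_funM.
have I0 : `]- (r0 / 2), r0 / 2[%classic (0 : R).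
  by rewrite /= in_itv/= oppr_lt0 divr_gt0.
have intf (r : R) : `]- (r0 / 2), r0 / 2[%classic r ->
    m.-integrable setT (EFin \o f r).
  rewrite /= in_itv/= => rr; apply: le_integrable iw => //.
    exact/measurable_EFinP/mf.
  move=> x _; rewrite /= !lee_fin /f !normrM ler_wpM2l//.
  rewrite !(ger0_norm (expR_ge0 _)) ler_expR (le_trans (ler_norm _))//.
  by rewrite normrM ler_wpM2r// ler_norml; lra.
pose G x := `|w x| * (2 / r0 * expR (r0 * `|z x|)).
have G0 x : 0 <= G x.
  by rewrite !mulr_ge0 ?expR_ge0// invr_ge0 ltW.
have intG : m.-integrable setT (EFin \o G).
  rewrite (_ : EFin \o G =
    (fun x => (2 / r0)%:E * `|(w x * expR (r0 * `|z x|))%:E|)%E).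
    by apply: integrableZl => //; apply: integrable_abse.
  apply/funext => x; rewrite /= -EFinM /G normrM (ger0_norm (expR_ge0 _)).
  by congr EFin; ring.
have G_ub r x : `]- (r0 / 2), r0 / 2[%classic r -> [set: T] x ->
    `|partial1of2 f r x| <= G x.
  rewrite /= in_itv/= => rr _; rewrite d1f !normrM -mulrA ler_wpM2l//.
  rewrite (ger0_norm (expR_ge0 _)).
  have -> : r0 * `|z x| = r0 / 2 * `|z x| + r0 / 2 * `|z x| by field.
  rewrite expRD mulrA ler_pM ?expR_ge0//.
    rewrite -ler_pdivrMl ?divr_gt0// invf_div.
    rewrite (le_trans _ (expR_ge1Dx _))//.
    have := normr_ge0 (z x); lra.
  rewrite ler_expR (le_trans (ler_norm _))// normrM ler_wpM2r//.
  by rewrite ler_norml; lra.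
have derf x r : `]- (r0 / 2), r0 / 2[%classic x -> [set: T] r ->
    derivable (f ^~ r) x 1 by move=> _ _; exact: (@ex_derive _ _ _ _ _ _ _ (df r x)).
have D := @derivable_under_integral R d T m f setT measurableT 0 _ _ I0 intf
  derf G G0 intG G_ub.
have V := @differentiation_under_integral R d T m f setT measurableT 0 _ _ I0
  intf derf G G0 intG G_ub.
apply: DeriveDef => //.
rewrite -derive1E V; apply: eq_Rintegral => x _.
by rewrite d1f mul0r expR0 mulr1.
Qed.

End derive_under_integral.

(** * Growth of functions on R^n measured against exponentials of the l1 norm *)

Section exponential_growth.
Context {R : realType} {n : nat}.
Implicit Types (t y : n.-tuple R) (g : n.-tuple R -> R).

(** The l1 norm is dual to the box condition [|t_i| <= r], and its exponential splits over the
    coordinates, so finitely many functions [exp <t, y>] dominate it. *)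
Definition l1norm y : R := \sum_(i < n) `|tnth y i|.

Lemma l1norm_ge0 y : 0 <= l1norm y.
Proof. exact: sumr_ge0. Qed.

Lemma normr_tnth_le_l1norm y i : `|tnth y i| <= l1norm y.
Proof. by rewrite /l1norm (bigD1 i)//= lerDl sumr_ge0. Qed.

Lemma measurable_l1norm : measurable_fun [set: n.-tuple R] l1norm.
Proof.
apply: measurable_sum => i.
by apply: measurableT_comp => //; exact: measurable_tnth.
Qed.

Lemma measurable_dot t : measurable_fun [set: n.-tuple R] (dot t).
Proof.
apply: measurable_sum => i.
by apply: measurable_funM => //; exact: measurable_tnth.
Qed.

Lemma normr_dot_le t y r : (forall i, `|tnth t i| <= r) ->
  `|dot t y| <= r * l1norm y.
Proof.
move=> tr; rewrite (le_trans (ler_norm_sum _ _ _))// mulr_sumr ler_sum// => i _.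
by rewrite normrM ler_wpM2r.
Qed.

(** Partial derivatives in [t] are handled as one-variable derivatives at 0 along this line. *)
Definition shift_coord t (i : 'I_n) (r : R) : n.-tuple R :=
  [tuple tnth t j + r *+ (j == i) | j < n].

Lemma tnth_shift_coord t i s j : tnth (shift_coord t i s) j = tnth t j + s *+ (j == i).
Proof. by rewrite tnth_mktuple. Qed.

Lemma dot_shift_coord t i r y :
  dot (shift_coord t i r) y = dot t y + r * tnth y i.
Proof.
rewrite /dot (bigD1 i)//= [in RHS](bigD1 i)//= tnth_mktuple eqxx mulr1n.
rewrite mulrDl -!addrA; congr (_ + _); rewrite addrC; congr (_ + _).
apply: eq_bigr => j /negbTE ji.
by rewrite tnth_mktuple ji mulr0n addr0.
Qed.

(** The largest of finitely many coordinates is still below [r]. The gap [e] is the room that later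
    absorbs polynomial factors. *)
Lemma uniform_gap t r : 0 < r -> (forall i, `|tnth t i| < r) ->
  exists2 e, 0 < e < r & forall i, `|tnth t i| <= r - e.
Proof.
move=> r0 tr; pose M := \big[Num.max/0]_(i < n) `|tnth t i|.
have M0 : 0 <= M by exact: bigmax_ge_id.
have Mr : M < r by apply/bigmax_ltP; split.
exists ((r - M) / 2) => [|i]; first lra.
have : `|tnth t i| <= M by exact: le_bigmax.
lra.
Qed.

Lemma near_shift_coord_box t i r : 0 < r -> (forall j, `|tnth t j| < r) ->
  \forall s \near (0 : R), forall j, `|tnth (shift_coord t i s) j| < r.
Proof.
move=> r0 tr; have [e /andP[e0 er] te] := uniform_gap r0 tr.
near=> s => j; rewrite tnth_shift_coord.
rewrite (le_lt_trans (ler_normD _ _))// -(subrK e r) ler_ltD//.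
have s_lt : `|s| < e by near: s; apply: (@nbhs0_lt R R) => //.
by rewrite normrMn; case: (j == i); rewrite ?mulr1n ?mulr0n.
Unshelve. all: by end_near. Qed.

(** The constant may depend on the rate, so a product can share a rate between its factors. The
    class thus contains all polynomials and is an algebra. *)
Definition subexponential g := measurable_fun [set: n.-tuple R] g /\
  forall r, 0 < r -> exists C, forall y, `|g y| <= C * expR (r * l1norm y).

Lemma subexponential_bounded g C : measurable_fun [set: n.-tuple R] g ->
  (forall y, `|g y| <= C) -> subexponential g.
Proof.
move=> mg gC; split=> // r r0; exists C => y.
rewrite (le_trans (gC y))// ler_peMr ?(le_trans _ (gC y))//.
rewrite -expR0 ler_expR mulr_ge0 ?l1norm_ge0//.
exact: ltW.
Qed.

Lemma subexponential_cst c : subexponential (cst c).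
Proof. exact: (@subexponential_bounded _ `|c|). Qed.

Lemma subexponential_tnth i : subexponential (fun y => tnth y i).
Proof.
split; first exact: measurable_tnth.
move=> r r0; exists r^-1 => y.
rewrite -ler_pdivrMl ?invr_gt0// invrK (le_trans _ (expR_ge1Dx _))//.
by have := normr_tnth_le_l1norm y i; rewrite -(ler_pM2l r0); lra.
Qed.

Lemma subexponentialM g1 g2 : subexponential g1 -> subexponential g2 ->
  subexponential (g1 \* g2).
Proof.
move=> [m1 b1] [m2 b2]; split; first exact: measurable_funM.
move=> r r0; have [|C1 h1] := b1 (r / 2); first by rewrite divr_gt0.
have [|C2 h2] := b2 (r / 2); first by rewrite divr_gt0.
exists (C1 * C2) => y; rewrite normrM.
have -> : r * l1norm y = r / 2 * l1norm y + r / 2 * l1norm y by field.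
by rewrite expRD mulrACA ler_pM.
Qed.

Lemma subexponentialD g1 g2 : subexponential g1 -> subexponential g2 ->
  subexponential (g1 \+ g2).
Proof.
move=> [m1 b1] [m2 b2]; split; first exact: measurable_funD.
move=> r r0; have [C1 h1] := b1 r r0; have [C2 h2] := b2 r r0.
by exists (C1 + C2) => y; rewrite mulrDl (le_trans (ler_normD _ _))// lerD.
Qed.

(** Indices may repeat; a list instead of a multi-index makes each partial derivative add exactly
    one [cons]. *)
Definition monomial (s : seq 'I_n) y := \prod_(i <- s) tnth y i.

Lemma subexponential_monomial s : subexponential (monomial s).
Proof.
elim: s => [|i s ih].
  rewrite (_ : monomial _ = cst 1); first exact: subexponential_cst.
  by apply/funext => y; rewrite /monomial big_nil.
rewrite (_ : monomial _ = (fun y => tnth y i) \* monomial s).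
  by apply: subexponentialM => //; exact: subexponential_tnth.
by apply/funext => y; rewrite /monomial big_cons.
Qed.

End exponential_growth.

(** * Signed weights with an exponential moment, and derivatives of their transforms *)

Section exponential_integrability.
Context {R : realType} {n : nat} {d} {T : measurableType d}.
Variable m : {measure set T -> \bar R}.
Implicit Types (h : T -> R) (psi : T -> n.-tuple R) (g : n.-tuple R -> R).

(** The image under [psi] of the signed measure [h m] has an exponential moment of rate [r]. Keeping
    [h] and [psi] separate covers both a density against a sum and the law of a transformed
    vector. *)
Definition exp_integrable h psi r :=
  [/\ 0 < r, measurable_fun [set: T] h, measurable_fun [set: T] psi &
    m.-integrable [set: T] (fun x => (h x * expR (r * l1norm (psi x)))%:E)].

Variables (h : T -> R) (psi : T -> n.-tuple R) (r : R).
Hypothesis hpsi : exp_integrable h psi r.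

Lemma measurable_exp_integrable g : measurable_fun [set: n.-tuple R] g ->
  measurable_fun [set: T] (fun x => h x * g (psi x)).
Proof.
by move=> mg; case: hpsi => *; apply: measurable_funM => //; exact: measurableT_comp.
Qed.

Lemma integrable_exp_dominated g C : measurable_fun [set: n.-tuple R] g ->
  (forall y, `|g y| <= C * expR (r * l1norm y)) ->
  m.-integrable [set: T] (fun x => (h x * g (psi x))%:E).
Proof.
move=> mg gC; case: (hpsi) => _ _ _ ih.
apply: (@le_integrable _ _ _ _ _ measurableT _
  (fun x => (C%:E * (h x * expR (r * l1norm (psi x)))%:E)%E)).
- exact/measurable_EFinP/measurable_exp_integrable.
- move=> x _; rewrite /= lee_fin !normrM mulrCA ler_wpM2l//.
  rewrite (ger0_norm (expR_ge0 _)) (le_trans (gC _))// ler_wpM2r ?expR_ge0//.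
  exact: ler_norm.
- exact: integrableZl.
Qed.

Lemma cvg_exp_dominated (g_ : nat -> n.-tuple R -> R) g C :
  (forall k, measurable_fun [set: n.-tuple R] (g_ k)) ->
  (forall k y, `|g_ k y| <= C * expR (r * l1norm y)) ->
  (forall y, g_ k y @[k --> \oo] --> g y) ->
  \int[m]_x (h x * g_ k (psi x)) @[k --> \oo] --> \int[m]_x (h x * g (psi x)).
Proof.
move=> mg gC gg; case: (hpsi) => _ _ _ ih.
have mlim : measurable_fun [set: n.-tuple R] g.
  by apply: (@measurable_fun_cvg _ _ _ _ g_) => // y _; exact: gg.
have limC y : `|g y| <= C * expR (r * l1norm y).
  have cn : `|g_ k y| @[k --> \oo] --> `|g y| by apply: cvg_norm; exact: gg.
  rewrite -(cvg_lim _ cn)//.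
  by apply: limr_le; [exact: cvgP cn|exact: nearW].
apply: fine_cvg; rewrite fineK; last first.
  apply: integrable_fin_num => //; exact: integrable_exp_dominated limC.
apply: (@dominated_cvg _ _ _ m setT _ (fun k x => (h x * g_ k (psi x))%:E) _
  (fun x => (`|(C%:E * (h x * expR (r * l1norm (psi x)))%:E)|)%E)) => //.
- by move=> k; apply/measurable_EFinP/measurable_exp_integrable.
- move=> x _; apply: cvg_EFin; first exact: nearW.
  by apply: cvgM; [exact: cvg_cst|exact: gg].
- by apply: integrable_abse; exact: integrableZl.
- move=> k x _; rewrite /= lee_fin !normrM mulrCA ler_wpM2l//.
  rewrite (ger0_norm (expR_ge0 _)) (le_trans (gC _ _))// ler_wpM2r ?expR_ge0//.
  exact: ler_norm.
Qed.

(** Half of the gap between [t] and the boundary of the box absorbs [g]. The other half is returned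
    as [e], the spare rate that differentiation requires. *)
Lemma subexponential_exp_dominated g t : subexponential g ->
  (forall i, `|tnth t i| < r) -> exists2 e, 0 < e & exists C, forall y,
  `|g y * expR (dot t y)| <= C * expR ((r - e) * l1norm y).
Proof.
move=> [mg bg] tr; case: (hpsi) => r0 _ _ _.
have [e /andP[e0 er] te] := uniform_gap r0 tr.
have [|C gC] := bg (e / 2); first by rewrite divr_gt0.
exists (e / 2); first by rewrite divr_gt0.
exists C => y.
have -> : (r - e / 2) * l1norm y = (e / 2) * l1norm y + (r - e) * l1norm y by field.
rewrite expRD mulrA normrM ler_pM//.
by rewrite (ger0_norm (expR_ge0 _)) ler_expR (le_trans (ler_norm _))// normr_dot_le.
Qed.

Lemma measurable_subexponential_exp g t : subexponential g ->
  measurable_fun [set: n.-tuple R] (fun y => g y * expR (dot t y)).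
Proof.
move=> [mg _]; apply: measurable_funM => //.
by apply: measurableT_comp => //; exact: measurable_dot.
Qed.

Lemma integrable_subexponential g t : subexponential g ->
  (forall i, `|tnth t i| < r) ->
  m.-integrable [set: T] (fun x => (h x * (g (psi x) * expR (dot t (psi x))))%:E).
Proof.
move=> sg tr; have [e e0 [C gC]] := subexponential_exp_dominated sg tr.
apply: (integrable_exp_dominated (g := fun y => g y * expR (dot t y)) (C := C)).
  exact: measurable_subexponential_exp.
move=> y; rewrite (le_trans (gC y))// ler_wpM2l//.
  by have := le_trans (normr_ge0 _) (gC y); rewrite pmulr_lge0// expR_gt0.
by rewrite ler_expR ler_wpM2r ?l1norm_ge0//; lra.
Qed.

Lemma integrable_subexponential0 g : subexponential g ->
  m.-integrable [set: T] (fun x => (h x * g (psi x))%:E).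
Proof.
move=> [mg bg]; case: (hpsi) => r0 _ _ _; have [C gC] := bg _ r0.
exact: integrable_exp_dominated gC.
Qed.

(** Shifting [t] along coordinate [i] multiplies the integrand by [exp (s psi_i)], so this is
    differentiation at 0 with weight [h g exp <t, psi>]; the spare rate [e] supplies its
    integrability hypothesis. *)
Lemma is_derive_laplace g t i : subexponential g -> (forall i, `|tnth t i| < r) ->
  is_derive (0 : R) 1
    (fun s => \int[m]_x (h x * (g (psi x) * expR (dot (shift_coord t i s) (psi x)))))
    (\int[m]_x (h x * (tnth (psi x) i * g (psi x) * expR (dot t (psi x))))).
Proof.
move=> sg tr; have [e e0 [C gC]] := subexponential_exp_dominated sg tr.
have [_ _ mpsi _] := hpsi.
have mi : measurable_fun [set: T] (fun x => tnth (psi x) i).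
  exact: (measurableT_comp (measurable_tnth i) mpsi).
rewrite (_ : (fun s => _) = fun s => \int[m]_x
    (h x * (g (psi x) * expR (dot t (psi x))) * expR (s * tnth (psi x) i))); last first.
  apply/funext => s; apply: eq_Rintegral => x _.
  by rewrite dot_shift_coord expRD !mulrA.
rewrite (_ : Rintegral _ _ _ = \int[m]_x
    (h x * (g (psi x) * expR (dot t (psi x))) * tnth (psi x) i)); last first.
  by apply: eq_Rintegral => x _; ring.
apply: (is_derive_Rintegral_expR e0) => //.
  exact: measurable_exp_integrable (measurable_subexponential_exp t sg).
rewrite (_ : (fun x => _) = fun x => (h x * (g (psi x) * expR (dot t (psi x)) *
    expR (e * `|tnth (psi x) i|)))%:E); last by apply/funext => x; rewrite !mulrA.
apply: (integrable_exp_dominated (C := C)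
   (g := fun y => g y * expR (dot t y) * expR (e * `|tnth y i|))).
  apply: measurable_funM; first exact: measurable_subexponential_exp.
  apply: measurableT_comp => //; apply: measurable_funM => //.
  by apply: measurableT_comp => //; exact: measurable_tnth.
move=> y; rewrite normrM.
have -> : r * l1norm y = (r - e) * l1norm y + e * l1norm y by ring.
rewrite expRD mulrA ler_pM// (ger0_norm (expR_ge0 _)) ler_expR ler_wpM2l//.
  exact: ltW.
exact: normr_tnth_le_l1norm.
Qed.

End exponential_integrability.

(** * Bounds and limits for the exponential and sine series *)

Section elementary_limits.
Context {R : realType}.
Implicit Types x : R.

Lemma series_exp_coeff_le x N : 0 <= x -> \sum_(k < N) x ^+ k / k`!%:R <= expR x.
Proof.
move=> x0; rewrite -(big_mkord xpredT (fun k => x ^+ k / k`!%:R)).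
apply: (@nondecreasing_cvgn_le _ (series (exp_coeff x))).
  by apply: nondecreasing_series => k _ _; exact: exp_coeff_ge0.
exact: is_cvg_series_exp_coeff.
Qed.

Lemma cvg_series_exp_coeff x : \sum_(k < N) x ^+ k / k`!%:R @[N --> \oo] --> expR x.
Proof.
rewrite (_ : (fun N => _) = series (exp_coeff x)).
  exact: is_cvg_series_exp_coeff.
by apply/funext => N; rewrite /series /= big_mkord.
Qed.

Lemma cvg_series_sin_coeff x : \sum_(k < N) sin_coeff x k @[N --> \oo] --> sin x.
Proof.
have -> : sin x = limn (series (sin_coeff x)) by rewrite unlock.
rewrite (_ : (fun N => _) = series (sin_coeff x)).
  exact: is_cvg_series_sin_coeff.
by apply/funext => N; rewrite /series /= big_mkord.
Qed.

Lemma series_sin_coeff_le x N : `|\sum_(k < N) sin_coeff x k| <= expR `|x|.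
Proof.
rewrite (le_trans (ler_norm_sum _ _ _))//.
rewrite (le_trans _ (series_exp_coeff_le N (normr_ge0 x)))// ler_sum// => k _.
rewrite /sin_coeff !normrM normrX normrN1 expr1n mulr1 normrX normfV.
rewrite !normr_nat ler_wpM2r ?invr_ge0// ler_piMl ?exprn_ge0//.
by case: (odd k).
Qed.

Lemma cvg_rescaled_sin x : k.+1%:R * sin (k.+1%:R^-1 * x) @[k --> \oo] --> x.
Proof.
(* The limit is the derivative of the sine at 0 read along [x / (k + 1)], a sequence that must avoid
   0. *)
have [->|x0] := eqVneq x 0.
  under eq_fun do rewrite mulr0 sin0 mulr0.
  exact: cvg_cst.
have [/cvg_ex[/= l dl] de] := is_derive_sin (0 : R).
have le : l = 1.
  rewrite -(cos0 R) -de; apply/esym/cvg_lim => //.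
move: dl; rewrite le => /cvgr_dnbhsP/(_ (fun k => k.+1%:R^-1 * x)) H.
have /H {}H : (forall k, k.+1%:R^-1 * x != 0) /\ k.+1%:R^-1 * x @[k --> \oo] --> (0 : R).
  split=> [k|]; first by rewrite mulf_neq0.
  rewrite -[X in _ --> X](mul0r x); apply: cvgM; last exact: cvg_cst.
  exact: cvg_harmonic.
have : x * ((k.+1%:R^-1 * x)^-1 *: (sin ((k.+1%:R^-1 * x) *: 1 + 0) - sin 0))
    @[k --> \oo] --> x * 1.
  by apply: cvgM H; exact: cvg_cst.
rewrite mulr1; apply: cvg_trans; apply: near_eq_cvg; apply: nearW => k.
rewrite sin0 subr0 addr0 /GRing.scale /= mulr1 invfM invrK.
by rewrite mulrCA -!mulrA mulKf.
Qed.

End elementary_limits.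

(** * A transform finite near 0 determines the weighted image measure *)

Section laplace_uniqueness.
Context {R : realType} {n : nat} {d} {T : measurableType d}.
Variable m : {measure set T -> \bar R}.
Variables (h1 h2 : T -> R) (psi1 psi2 : T -> n.-tuple R) (r : R).
Hypotheses (E1 : exp_integrable m h1 psi1 r) (E2 : exp_integrable m h2 psi2 r).
Implicit Types (g a u : n.-tuple R -> R) (s : seq 'I_n) (t : n.-tuple R).

Let agree g := \int[m]_x (h1 x * g (psi1 x)) = \int[m]_x (h2 x * g (psi2 x)).

Hypothesis laplaceE : forall t, (forall i, `|tnth t i| < r) ->
  agree (fun y => expR (dot t y)).

Let r_gt0 : 0 < r. Proof. by case: E1. Qed.

(** The induction hypothesis holds at every point near [t], so both sides have the same partial
    derivative at [t]; each derivative brings down one coordinate. *)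
Let agree_monomial_expR s t : (forall i, `|tnth t i| < r) ->
  agree (fun y => monomial s y * expR (dot t y)).
Proof.
elim: s t => [|i s ih] t tr.
  rewrite (_ : (fun y => _) = fun y => expR (dot t y)); first exact: laplaceE.
  by apply/funext => y; rewrite /monomial big_nil mul1r.
have sm := subexponential_monomial (R := R) s.
have D1 := is_derive_laplace E1 i sm tr.
have D2 := is_derive_laplace E2 i sm tr.
rewrite /agree.
under eq_Rintegral do rewrite /monomial big_cons -/(monomial s _).
under [RHS]eq_Rintegral do rewrite /monomial big_cons -/(monomial s _).
rewrite -(@derive_val _ _ _ _ _ _ _ D1) -(@derive_val _ _ _ _ _ _ _ D2).
apply: near_eq_derive.
near=> z; apply: ih; near: z; exact: near_shift_coord_box.
Unshelve. all: by end_near. Qed.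

Let agreeD g1 g2 : subexponential g1 -> subexponential g2 ->
  agree g1 -> agree g2 -> agree (g1 \+ g2).
Proof.
move=> s1 s2 a1 a2; rewrite /agree.
under eq_Rintegral do rewrite /= mulrDr.
under [RHS]eq_Rintegral do rewrite /= mulrDr.
have I1 := integrable_subexponential0 E1; have I2 := integrable_subexponential0 E2.
rewrite !RintegralD ?a1 ?a2//; by [exact: I1|exact: I2].
Qed.

Let agreeZ c g : subexponential g -> agree g -> agree (c \*: g).
Proof.
move=> sg ag; rewrite /agree.
under eq_Rintegral do rewrite /= /GRing.scale /= mulrCA.
under [RHS]eq_Rintegral do rewrite /= /GRing.scale /= mulrCA.
rewrite !RintegralZl ?ag//.
- exact: (integrable_subexponential0 E2 sg).
- exact: (integrable_subexponential0 E1 sg).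
Qed.

Let agree_lim (g_ : nat -> n.-tuple R -> R) g C :
  (forall k, measurable_fun [set: n.-tuple R] (g_ k)) ->
  (forall k y, `|g_ k y| <= C * expR (r * l1norm y)) ->
  (forall y, g_ k y @[k --> \oo] --> g y) ->
  (forall k, agree (g_ k)) -> agree g.
Proof.
move=> mg gC gg ag.
have := cvg_exp_dominated E1 mg gC gg; under eq_fun do rewrite ag.
move=> L1; have L2 := cvg_exp_dominated E2 mg gC gg.
exact: cvg_unique L1 L2.
Qed.

(** All monomials are required, not the empty one alone, so that a power series in a coordinate can
    be multiplied in term by term. *)
Let same_moments g := subexponential g /\ forall s, agree (monomial s \* g).

(* The multipliers form an algebra that is closed under bounded pointwise
   limits, so the sets whose indicator is a multiplier form a sigma-algebra.
   It contains the Borel sets because the functions [sin (c y_i)] with small [c]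
   are multipliers, their power series being dominated by [exp (c |y_i|)]. *)
Let multiplier a := [/\ measurable_fun [set: n.-tuple R] a,
  exists C : R, forall y, `|a y| <= C &
  forall g, same_moments g -> same_moments (a \* g)].

Let same_moments1 : same_moments (cst 1).
Proof.
split; first exact: subexponential_cst.
move=> s; have := @agree_monomial_expR s [tuple 0 | i < n].
rewrite (_ : (fun y => _) = monomial s \* cst 1).
  by apply=> i; rewrite tnth_mktuple normr0.
apply/funext => y; rewrite /= (_ : dot _ _ = 0) ?expR0//.
by rewrite /dot big1// => i _; rewrite tnth_mktuple mul0r.
Qed.

Let multiplier_cst c : multiplier (cst c).
Proof.
split=> //; first by exists `|c|.
move=> g [sg ag]; split.
  by apply: subexponentialM => //; exact: subexponential_cst.
move=> s; rewrite (_ : _ \* _ = c \*: (monomial s \* g)).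
  apply: agreeZ => //; apply: subexponentialM => //.
  exact: subexponential_monomial.
by apply/funext => y /=; rewrite mulrCA.
Qed.

Let multiplierM a1 a2 : multiplier a1 -> multiplier a2 -> multiplier (a1 \* a2).
Proof.
move=> [m1 [C1 b1] H1] [m2 [C2 b2] H2]; split; first exact: measurable_funM.
  by exists (C1 * C2) => y; rewrite normrM ler_pM.
move=> g /H2/H1; rewrite (_ : a1 \* (a2 \* g) = a1 \* a2 \* g)//.
by apply/funext => y /=; rewrite mulrA.
Qed.

Let multiplierD a1 a2 : multiplier a1 -> multiplier a2 -> multiplier (a1 \+ a2).
Proof.
move=> [m1 [C1 b1] H1] [m2 [C2 b2] H2].
have m12 : measurable_fun setT (a1 \+ a2) by exact: measurable_funD.
have b12 y : `|(a1 \+ a2) y| <= C1 + C2.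
  by rewrite (le_trans (ler_normD _ _))// lerD.
split => //; first by exists (C1 + C2).
move=> g Kg; have [s1 ag1] := H1 _ Kg; have [s2 ag2] := H2 _ Kg.
split.
  by apply: subexponentialM; [exact: subexponential_bounded b12|case: Kg].
move=> s; rewrite (_ : _ \* _ = (monomial s \* (a1 \* g)) \+ (monomial s \* (a2 \* g))).
  have sm := subexponential_monomial (R := R) s.
  by apply: agreeD => //; apply: subexponentialM.
by apply/funext => y /=; rewrite -mulrDr -mulrDl.
Qed.

Let multiplier_sum N (a_ : nat -> n.-tuple R -> R) :
  (forall k, multiplier (a_ k)) -> multiplier (fun y => \sum_(k < N) a_ k y).
Proof.
move=> ma; elim: N => [|N ih].
  rewrite (_ : (fun y => _) = cst 0)//.
  by apply/funext => y; rewrite big_ord0.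
rewrite (_ : (fun y => _) = (fun y => \sum_(k < N) a_ k y) \+ a_ N).
  exact: multiplierD.
by apply/funext => y; rewrite big_ord_recr.
Qed.

Let multiplierX a k : multiplier a -> multiplier (fun y => a y ^+ k).
Proof.
move=> ma; elim: k => [|k ih].
  by rewrite (_ : (fun y => _) = cst 1).
rewrite (_ : (fun y => _) = a \* (fun y => a y ^+ k)); first exact: multiplierM.
by apply/funext => y; rewrite exprS.
Qed.

Let multiplier_lim (a_ : nat -> n.-tuple R -> R) a (M : R) :
  (forall k, multiplier (a_ k)) -> (forall k y, `|a_ k y| <= M) ->
  (forall y, a_ k y @[k --> \oo] --> a y) -> multiplier a.
Proof.
move=> ma bM aa.
have m_ k : measurable_fun setT (a_ k) by case: (ma k).
have m0 : measurable_fun setT a.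
  by apply: (@measurable_fun_cvg _ _ _ _ a_) => // y _; exact: aa.
have b0 y : `|a y| <= M.
  have cn : `|a_ k y| @[k --> \oo] --> `|a y| by apply: cvg_norm; exact: aa.
  rewrite -(cvg_lim _ cn)//.
  by apply: limr_le; [exact: cvgP cn|exact: nearW].
split=> //; first by exists M.
move=> g Kg; have [sg _] := Kg; split.
  by apply: subexponentialM => //; exact: subexponential_bounded b0.
move=> s; have [mq bq] := subexponentialM (subexponential_monomial (R := R) s) sg.
have [C qC] := bq _ r_gt0.
apply: (@agree_lim (fun k => monomial s \* (a_ k \* g)) _ (C * M)).
- move=> k; have [_ _ /(_ _ Kg)[sk _]] := ma k.
  by have [] := subexponentialM (subexponential_monomial (R := R) s) sk.
- move=> k y; rewrite /= mulrCA normrM mulrC mulrAC ler_pM//; exact: qC.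
- move=> y; apply: cvgM; first exact: cvg_cst.
  by apply: cvgM; [exact: aa|exact: cvg_cst].
- by move=> k; have [_ _ /(_ _ Kg)[_]] := ma k; apply.
Qed.

Let multiplier_sin c i : 0 < c < r -> multiplier (fun y => sin (c * tnth y i)).
Proof.
move=> /andP[c0 cr].
have ms : measurable_fun setT (fun y : n.-tuple R => sin (c * tnth y i)).
  apply: (measurableT_comp (continuous_measurable_fun (@continuous_sin R))).
  by apply: measurable_funM => //; exact: measurable_tnth.
have bs (y : n.-tuple R) : `|sin (c * tnth y i)| <= 1 by exact: sin_max.
split=> //; first by exists 1.
move=> g [sg ag]; split.
  by apply: subexponentialM => //; exact: subexponential_bounded bs.
move=> s; pose q k : n.-tuple R -> R := monomial (nseq k i ++ s) \* g.
have sq k : subexponential (q k).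
  by apply: subexponentialM => //; exact: subexponential_monomial.
have aq k : agree (q k) by exact: ag.
have qE k y : q k y = tnth y i ^+ k * (monomial s y * g y).
  rewrite /q /= /monomial big_cat /= -mulrA; congr (_ * _).
  by rewrite big_nseq iter_mulr mulr1.
pose p N : n.-tuple R -> R := fun y => \sum_(k < N) sin_coeff c k *: q k y.
have pE N y : p N y = (\sum_(k < N) sin_coeff (c * tnth y i) k) * (monomial s y * g y).
  rewrite /p mulr_suml; apply: eq_bigr => k _; rewrite qE /GRing.scale /=.
  by rewrite /sin_coeff /= exprMn; ring.
have [mq bq] := subexponentialM (subexponential_monomial (R := R) s) sg.
(* The rate [r] is shared: [r - c] for the fixed factor, and [c] for the partial sums of the sine,
   which are at most [exp (c |y_i|)]. *)
have [|C qC] := bq (r - c); first lra.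
have sp N : subexponential (p N) /\ agree (p N).
  elim: N => [|N [sN aN]].
    rewrite (_ : p 0 = 0 \*: q 0).
      split; last exact: agreeZ.
      rewrite (_ : _ \*: _ = cst 0); first exact: subexponential_cst.
      by apply/funext => y; exact: scale0r.
    by apply/funext => y; rewrite /p big_ord0 [RHS]scale0r.
  have -> : p N.+1 = p N \+ (sin_coeff c N \*: q N).
    by apply/funext => y; rewrite /p big_ord_recr.
  have sz : subexponential (sin_coeff c N \*: q N).
    by apply: (subexponentialM (g1 := cst (sin_coeff c N))) => //; exact: subexponential_cst.
  split; first exact: subexponentialD.
  by apply: agreeD => //; exact: agreeZ.
apply: (@agree_lim p _ C).
- by move=> N; case: (sp N) => -[].
- move=> N y; rewrite pE normrM mulrC.
  have -> : r * l1norm y = (r - c) * l1norm y + c * l1norm y by ring.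
  rewrite expRD mulrA ler_pM//; first exact: qC.
  rewrite (le_trans (series_sin_coeff_le _ _))// ler_expR normrM (gtr0_norm c0).
  by rewrite ler_pM2l// normr_tnth_le_l1norm.
- move=> y; under eq_fun do rewrite pE.
  rewrite (_ : _ y = sin (c * tnth y i) * (monomial s y * g y)); last first.
    by rewrite /= mulrCA.
  by apply: cvgM; [exact: cvg_series_sin_coeff|exact: cvg_cst].
- by move=> N; case: (sp N).
Qed.

(** The partial sums of the exponential series are polynomials in [a], and the bound [M] on [a]
    bounds them all by [exp M]. *)
Let multiplier_expR a : multiplier a -> multiplier (fun y => expR (a y)).
Proof.
move=> ma; have [_ [M aM] _] := ma.
apply: (@multiplier_lim (fun N y => \sum_(k < N) a y ^+ k / k`!%:R) _ (expR M)).
- move=> N; apply: (@multiplier_sum N (fun k y => a y ^+ k / k`!%:R)) => k.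
  apply: (@multiplierM (fun y => a y ^+ k) (cst (k`!%:R)^-1)) => //.
  exact: multiplierX.
- move=> N y; rewrite (le_trans (ler_norm_sum _ _ _))//.
  apply: (@le_trans _ _ (expR `|a y|)); last by rewrite ler_expR.
  rewrite (le_trans _ (series_exp_coeff_le N (normr_ge0 (a y))))// ler_sum// => k _.
  by rewrite normrM normrX normfV normr_nat.
- by move=> y; exact: cvg_series_exp_coeff.
Qed.

(* [exp (- exp (- k u))] tends to [1], [1/e] or [0] as [u] is positive, zero or
   negative; taking powers then removes the value [1/e]. *)
Let multiplier_gt0 u : multiplier u -> multiplier (fun y => (0 < u y)%R%:R).
Proof.
move=> mu.
pose v y : R := if 0 < u y then 1 else if u y == 0 then expR (-1) else 0.
have mv : multiplier v.
  apply: (@multiplier_lim (fun k y => expR (- expR (- (k%:R * u y)))) _ 1).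
  - move=> k; apply: (@multiplier_expR (fun y => - expR (- (k%:R * u y)))).
    rewrite (_ : (fun y => _) = cst (-1) \* (fun y => expR (- (k%:R * u y)))); last first.
      by apply/funext => y; rewrite /= mulN1r.
    apply: multiplierM => //; apply: (@multiplier_expR (fun y => - (k%:R * u y))).
    rewrite (_ : (fun y => _) = cst (- k%:R) \* u); last first.
      by apply/funext => y; rewrite /= mulNr.
    exact: multiplierM.
  - by move=> k y; rewrite ger0_norm ?expR_ge0// -expR0 ler_expR oppr_le0 expR_ge0.
  - move=> y; rewrite /v; have [u0|u0|u0] := ltgtP (u y) 0.
    (* From [exp v >= v] with [v = - k u], the exponent is at most [k u], so the term is at most
       [exp (u) ^ k] with [exp u < 1]. *)
    + apply: (@squeeze_cvgr _ _ _ _ (cst 0) (fun k => expR (u y) ^+ k)).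
      * apply: nearW => k; rewrite expR_ge0/= -expRM_natl ler_expR.
        rewrite -mulrN; have := expR_ge1Dx (k%:R * - u y).
        lra.
      * exact: cvg_cst.
      * by apply: cvg_expr; rewrite ger0_norm ?expR_ge0// expR_lt1.
    + rewrite -[X in _ --> X]expR0.
      apply: continuous_cvg; first exact: continuous_expR.
      rewrite -[X in _ --> X]oppr0; apply: cvgN.
      under eq_fun do rewrite -mulrN expRM_natl.
      by apply: cvg_expr; rewrite ger0_norm ?expR_ge0// expR_lt1 oppr_lt0.
    + rewrite u0; under eq_fun do rewrite mulr0 oppr0 expR0.
      exact: cvg_cst.
apply: (@multiplier_lim (fun k y => v y ^+ k) _ 1).
- by move=> k; exact: multiplierX.
- move=> k y; rewrite normrX exprn_ile1// /v.
  case: ifP => _; first by rewrite normr1.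
  case: ifP => _; last by rewrite normr0.
  by rewrite ger0_norm ?expR_ge0// -expR0 ler_expR; lra.
- move=> y; rewrite /v; case: ifP => _.
    by under eq_fun do rewrite expr1n; exact: cvg_cst.
  apply: cvg_expr; case: ifP => _; last by rewrite normr0.
  by rewrite ger0_norm ?expR_ge0// expR_lt1; lra.
Qed.

Let multiplier_set (E : set (n.-tuple R)) := measurable E /\ multiplier \1_E.

Let sigma_algebra_multiplier_set : sigma_algebra [set: n.-tuple R] multiplier_set.
Proof.
split.
- by split=> //; rewrite indic0; exact: multiplier_cst.
- move=> E [mE mulE]; rewrite setTD; split; first exact: measurableC.
  rewrite (_ : \1_ _ = cst 1 \+ (cst (-1) \* \1_E)).
    by apply: multiplierD => //; exact: multiplierM.
  apply/funext => y; rewrite /= !indicE in_setC.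
  by case: (y \in E); rewrite /= ?mulr1 ?mulr0 ?subrr ?addr0.
move=> F mF; split; first by apply: bigcup_measurable => k _; case: (mF k).
(* The indicator of the union is 1 minus the infinite product of the indicators of the complements;
   its finite products stay in [0, 1] and are eventually constant at each point. *)
pose a k : n.-tuple R -> R := cst 1 \+ (cst (-1) \* \1_(F k)).
have ma k : multiplier (a k).
  by apply: multiplierD => //; apply: multiplierM => //; case: (mF k).
have aE k y : a k y = (y \notin F k)%:R.
  rewrite /a /= indicE.
  by case: (y \in F k); rewrite /= ?mulr1 ?mulr0 ?subrr ?addr0.
pose b N : n.-tuple R -> R := cst 1 \+ (cst (-1) \* (fun y => \prod_(k < N) a k y)).
have bE N y : b N y = 1 - \prod_(k < N) a k y by rewrite /b /= mulN1r.
have p01 N y : 0 <= \prod_(k < N) a k y <= 1.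
  have a01 k : 0 <= a k y <= 1 by rewrite aE ler0n lern1 leq_b1.
  rewrite prodr_ile1// ?prodr_ge0// => k _.
  by case/andP: (a01 k).
apply: (@multiplier_lim b _ 1).
- move=> N; apply: multiplierD => //; apply: multiplierM => //.
  elim: N => [|N ih].
    rewrite (_ : (fun y => _) = cst 1)//.
    by apply/funext => y; rewrite big_ord0.
  rewrite (_ : (fun y => _) = (fun y => \prod_(k < N) a k y) \* a N).
    exact: multiplierM.
  by apply/funext => y; rewrite big_ord_recr.
- by move=> N y; rewrite bE ger0_norm; have := p01 N y; lra.
move=> y; rewrite indicE; case: (asboolP (y \in \bigcup_k F k)) => [|nF].
  move=> yF; rewrite yF; move: yF; rewrite inE => -[k0 _ yk0].
  apply: cvg_near_cst; exists k0.+1 => // N /= kN.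
  by rewrite bE (bigD1 (Ordinal kN))//= aE mem_set//= mul0r subr0.
move/negP/negbTE: (nF) => ->.
rewrite (_ : (fun N => _) = cst 0); first exact: cvg_cst.
apply/funext => N; rewrite bE big1 ?subrr// => k _.
rewrite aE; suff -> : y \notin F k by [].
by apply/negP; rewrite inE => yk; apply: nF; rewrite inE; exists k.
Qed.

(* [k sin (y_i / k)] tends to [y_i]. *)
Let multiplier_set_coord i (Y : set R) : measurable Y ->
  multiplier_set ((fun y => tnth y i) @^-1` Y).
Proof.
(* R^n is given the multiplier sets as its sigma-algebra, so that the coordinate inherits
   measurability as a pointwise limit of functions measurable for it. *)
move=> mY; pose T' := g_sigma_algebraType multiplier_set.
have T'E : @measurable _ T' = multiplier_set.
  exact: sigma_algebra_id.
(* Starting the sequence at [k0] keeps all frequencies below [r], as [multiplier_sin] demands. *)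
have [k0 k0r] : exists k0 : nat, k0.+1%:R^-1 < r.
  have /cvgrPdist_lt/(_ _ r_gt0)[k0 _ /(_ _ (leqnn k0))] := @cvg_harmonic R.
  by rewrite sub0r normrN => /ltr_normlW; exists k0.
pose f k : T' -> R := fun y => (k + k0).+1%:R * sin ((k + k0).+1%:R^-1 * tnth y i).
have mf k : measurable_fun setT (f k).
  apply: (measurability _ (RGenOInfty.measurableE R)) => // _ [_ [x ->] <-].
  rewrite setTI T'E.
  pose u : n.-tuple R -> R := (cst (k + k0).+1%:R \*
    (fun y => sin ((k + k0).+1%:R^-1 * tnth y i))) \+ cst (- x).
  have mulu : multiplier u.
    apply: multiplierD => //; apply: multiplierM => //; apply: multiplier_sin.
    rewrite invr_gt0 ltr0n/= (le_lt_trans _ k0r)// lef_pV2 ?posrE ?ltr0n//.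
    by rewrite ler_nat ltnS leq_addl.
  have [mu' _ _] := mulu.
  have uE : f k @^-1` `]x, +oo[ = u @^-1` `]0, +oo[.
    by apply/seteqP; split=> y /=; rewrite !in_itv/= !andbT subr_gt0.
  split.
    by rewrite uE -[X in measurable X]setTI; exact: mu'.
  rewrite uE (_ : \1_ _ = (fun y => (0 < u y)%R%:R)); first exact: multiplier_gt0.
  apply/funext => y; rewrite indicE; congr (_%:R); congr nat_of_bool.
  by apply/idP/idP; rewrite inE /= in_itv/= andbT.
have mc : measurable_fun [set: T'] (fun y => tnth y i).
  apply: (@measurable_fun_cvg _ T' _ _ f) => // y _.
  have := @cvg_rescaled_sin R (tnth y i); rewrite -(cvg_shiftn k0).
  exact.
by have := mc measurableT _ mY; rewrite setTI T'E.
Qed.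

(** Used in two ways: with one map and two weights it compares conditional expectations; with weight
    1 and two maps it compares laws. *)
Theorem laplace_unique (E : set (n.-tuple R)) : measurable E ->
  \int[m]_(x in psi1 @^-1` E) h1 x = \int[m]_(x in psi2 @^-1` E) h2 x.
Proof.
move=> mE.
(* The multiplier [\1_E] is applied to the constant 1, and only the empty monomial is kept. *)
have [_ [_ _ /(_ _ same_moments1)[_ /(_ [::])]]] : multiplier_set E.
  move: E mE; apply: smallest_sub => //.
  rewrite -bigcup_seq; apply: bigcup_sub => i _ _ [Y mY <-]; rewrite setTI.
  exact: multiplier_set_coord.
rewrite /agree.
have S h psi : \int[m]_x (h x * (monomial [::] \* (\1_E \* cst 1)) (psi x)) =
    \int[m]_(x in psi @^-1` E) h x.
  rewrite [RHS]Rintegral_mkcond; apply: eq_Rintegral => x _.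
  rewrite /= /monomial big_nil mul1r mulr1 patchE indicE.
  by rewrite -[x \in _]/(psi x \in E); case: ifP; rewrite ?mulr1 ?mulr0.
by rewrite !S.
Qed.

End laplace_uniqueness.

(** * Gamma and Bessel functions *)

Section gamma_function.
Context {R : realType}.
Notation leb := (@lebesgue_measure R).
Implicit Types x t : R.

Definition gamma_kernel x t : R := t `^ (x - 1) * expR (- t).

Definition gamma_integral x : \bar R :=
  (\int[leb]_(t in `]0%R, +oo[) (gamma_kernel x t)%:E)%E.

Lemma gamma_kernel_ge0 x t : 0 <= gamma_kernel x t.
Proof. by rewrite mulr_ge0 ?powR_ge0 ?expR_ge0. Qed.

Lemma continuous_powR_gt0 x t : 0 < t -> {for t, continuous (fun t => t `^ x)}.
Proof.
move=> t0; apply: differentiable_continuous; apply/derivable1_diffP.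
exact: (@ex_derive _ _ _ _ _ _ _ (is_derive1_powR x t0)).
Qed.

Lemma continuous_expRN t : {for t, continuous (fun t : R => expR (- t))}.
Proof.
by apply: continuous_comp; [exact: opp_continuous|exact: continuous_expR].
Qed.

Lemma continuous_gamma_kernel x t : 0 < t -> {for t, continuous (gamma_kernel x)}.
Proof.
move=> t0; apply: continuousM; first exact: continuous_powR_gt0.
exact: continuous_expRN.
Qed.

Lemma measurable_gamma_kernel x : measurable_fun (`]0, +oo[ : set R) (gamma_kernel x).
Proof.
apply: open_continuous_measurable_fun; first exact: interval_open.
move=> t; rewrite inE/= in_itv/= andbT; exact: continuous_gamma_kernel.
Qed.

(** These compact intervals avoid the singularity at 0, so integration by parts applies on each. The
    shift by 2 makes even the first one nondegenerate. *)
Let K n : set R := `[n.+2%:R^-1, n.+2%:R]%classic.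

Let K_gt0 n t : K n t -> 0 < t.
Proof. by rewrite /K/= in_itv/= => /andP[+ _]; apply: lt_le_trans. Qed.

Let bigcup_K : \bigcup_n K n = `]0, +oo[%classic.
Proof.
apply/seteqP; split=> [t [n _ /K_gt0]|t]; rewrite /= in_itv/= andbT// => t0.
have [n tn] : exists n : nat, t <= n%:R /\ t^-1 <= n%:R.
  exists (maxn (Num.bound t) (Num.bound t^-1)); split.
    rewrite (le_trans (ltW (archi_boundP (ltW t0))))// ler_nat leq_maxl//.
  by rewrite (le_trans (ltW (archi_boundP _)))// ?ler_nat ?leq_maxr// invr_ge0 ltW.
case: tn => tn tVn.
have nn2 : n%:R <= n.+2%:R :> R by rewrite ler_nat leqW.
exists n => //; rewrite /K/= in_itv/= (le_trans tn nn2) andbT.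
by rewrite -[leRHS]invrK lef_pV2 ?posrE ?invr_gt0// (le_trans tVn).
Qed.

Let cvg_K x : (\int[leb]_(t in K n) (gamma_kernel x t)%:E)%E @[n --> \oo] -->
  gamma_integral x.
Proof.
rewrite /gamma_integral -bigcup_K.
apply: ge0_nondecreasing_set_cvg_integral => [|n|n|n t _].
- apply/nondecreasing_seqP => n; rewrite subsetEset => t; rewrite /K/= !in_itv/=.
  move=> /andP[t1 t2]; apply/andP; split.
    by rewrite (le_trans _ t1)// lef_pV2 ?posrE// ler_nat.
  by rewrite (le_trans t2)// ler_nat.
- exact: measurable_itv.
- apply/measurable_EFinP; apply: measurable_funS (measurable_gamma_kernel x) => //.
  by rewrite -bigcup_K; exact: bigcup_sup.
- by rewrite lee_fin gamma_kernel_ge0.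
Qed.

(** The boundary term when [t^x exp (- t)] is integrated by parts over [K n]. *)
Let bdry x n : R := n.+2%:R^-1 `^ x * expR (- n.+2%:R^-1) -
  n.+2%:R `^ x * expR (- n.+2%:R).

Let cvg_bdry x : 1 <= x -> bdry x n @[n --> \oo] --> 0.
Proof.
move=> x1; rewrite -[X in _ --> X](subrr 0); apply: cvgB.
  apply: (@squeeze_cvgr _ _ _ _ (cst 0) (fun n => n.+1%:R^-1)).
  - apply: nearW => n; rewrite mulr_ge0 ?powR_ge0 ?expR_ge0//=.
    apply: (@le_trans _ _ (n.+2%:R^-1 `^ x)).
      by rewrite ler_piMr ?powR_ge0// -expR0 ler_expR oppr_le0.
    apply: (@le_trans _ _ n.+2%:R^-1).
      by apply: ge1r_powR => //; rewrite invr_gt0 ltr0n/= invf_le1 ?ler1n.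
    by rewrite lef_pV2 ?posrE// ler_nat.
  - exact: cvg_cst.
  - exact: cvg_harmonic.
(* [N] bounds the exponent [x], and [exp b >= b^(N + 1) / (N + 1)!] leaves one factor [1 / b] to
   spare. *)
pose N := Num.bound x.
apply: (@squeeze_cvgr _ _ _ _ (cst 0) (fun n => N.+1`!%:R * n.+1%:R^-1)).
- apply: nearW => n; rewrite mulr_ge0 ?powR_ge0 ?expR_ge0//=.
  rewrite expRN ler_pdivrMr ?expR_gt0//.
  apply: (@le_trans _ _ (n.+2%:R ^+ N)).
    rewrite -powR_mulrn//; apply: ler_powR; first by rewrite ler1n.
    by apply/ltW/archi_boundP; rewrite (le_trans ler01 x1).
  rewrite -mulrA -ler_pdivrMl ?ltr0n ?fact_gt0// -ler_pdivrMl ?invr_gt0// invrK.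
  have := @expR_ge1Dxn R n.+2%:R N (ler0n _ _).
  apply: le_trans; rewrite -[leLHS]add0r lerD//.
  rewrite [in leRHS]mulrC mulrCA ler_wpM2l ?invr_ge0// exprS ler_wpM2r ?exprn_ge0//.
  by rewrite ler_nat.
- exact: cvg_cst.
- by rewrite -[X in _ --> X](mulr0 N.+1`!%:R); apply: cvgM; [exact: cvg_cst|exact: cvg_harmonic].
Qed.

Let parts x n : 0 <= x ->
  (\int[leb]_(t in K n) (gamma_kernel (x + 1) t)%:E =
   (bdry x n)%:E + x%:E * \int[leb]_(t in K n) (gamma_kernel x t)%:E)%E.
Proof.
move=> x0; have ab : n.+2%:R^-1 < n.+2%:R :> R.
  by rewrite (@lt_trans _ _ 1)// ?ltr1n// invf_lt1 ?ltr1n.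
have dF t : 0 < t -> is_derive t 1 (fun t => t `^ x) (x * t `^ (x - 1)).
  exact: is_derive1_powR.
have dG t : is_derive t 1 (fun t => - expR (- t)) (expR (- t)).
  have D : is_derive t 1 (expR \o -%R) (expR (- t) * -1) by exact: is_derive1_comp.
  by apply: is_derive_eq; rewrite mulrN1 opprK.
have pos t : t \in `[n.+2%:R^-1, n.+2%:R] -> 0 < t by move=> tn; exact: (@K_gt0 n).
have posa : 0 < n.+2%:R^-1 :> R by rewrite invr_gt0.
have cf : {within `[n.+2%:R^-1, n.+2%:R], continuous (fun t => x * t `^ (x - 1))}.
  apply: continuous_in_subspaceT => t; rewrite inE => /pos t0.
  by apply: cvgM; [exact: cvg_cst|exact: continuous_powR_gt0].
have cg : {within `[n.+2%:R^-1, n.+2%:R], continuous (fun t : R => expR (- t))}.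
  by apply: continuous_subspaceT => t; exact: continuous_expRN.
have cF t : 0 < t -> {for t, continuous (fun t => t `^ x)} by exact: continuous_powR_gt0.
have cG t : {for t, continuous (fun t : R => - expR (- t))}.
  by apply: cvgN; exact: continuous_expRN.
rewrite (_ : (\int[leb]_(t in K n) _)%E =
    (\int[leb]_(t in `[(n.+2%:R^-1)%R, n.+2%:R%R]) (t `^ x * expR (- t))%:E)%E); last first.
  by apply: eq_integral => t _; rewrite /gamma_kernel addrK.
rewrite (integration_by_parts (G := fun t => - expR (- t))
  (f := fun t => x * t `^ (x - 1)) ab cf) => //; last 4 first.
- split => [t /subset_itv_oo_cc/pos t0||].
  + exact: (@ex_derive _ _ _ _ _ _ _ (dF t t0)).
  + by apply: cvg_at_right_filter; exact: cF.
  + by apply: cvg_at_left_filter; exact: cF.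
- by move=> t /subset_itv_oo_cc/pos t0; rewrite derive1E (@derive_val _ _ _ _ _ _ _ (dF t t0)).
- split => [t _||].
  + exact: (@ex_derive _ _ _ _ _ _ _ (dG t)).
  + by apply: cvg_at_right_filter; exact: cG.
  + by apply: cvg_at_left_filter; exact: cG.
- by move=> t _; rewrite derive1E (@derive_val _ _ _ _ _ _ _ (dG t)).
congr (_ + _)%E; first by congr EFin; rewrite /bdry; ring.
under eq_integral do rewrite mulrN EFinN -mulrA EFinM.
have mk : measurable_fun (K n) (EFin \o gamma_kernel x).
  apply/measurable_EFinP; apply: measurable_funS (measurable_gamma_kernel x) => //.
  by rewrite -bigcup_K; exact: bigcup_sup.
rewrite integral_ge0N ?oppeK => [|t _]; last first.
  by rewrite -EFinM lee_fin mulr_ge0// gamma_kernel_ge0.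
rewrite ge0_integralZl// => t _.
by rewrite lee_fin gamma_kernel_ge0.
Qed.

(** Limit of [parts] along [K n]. Working in the extended reals allows the recursion to come before
    finiteness, which is then deduced from it. *)
Lemma gamma_integralS x : 1 <= x ->
  gamma_integral (x + 1) = (x%:E * gamma_integral x)%E.
Proof.
move=> x1; have L1 := @cvg_K (x + 1).
have L2 : ((bdry x n)%:E + x%:E * \int[leb]_(t in K n) (gamma_kernel x t)%:E)%E
    @[n --> \oo] --> (0%:E + x%:E * gamma_integral x)%E.
  apply: cvgeD; [by []| |].
    by apply: cvg_EFin; [exact: nearW|exact: cvg_bdry].
  by apply: cvgeZl => //; exact: cvg_K.
move: L1; under eq_fun do rewrite parts ?(le_trans ler01)//.
by move=> L1; rewrite (cvg_unique _ L1 L2) ?add0e.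
Qed.

(* [fine] maps an infinite integral to [0], which does not harm the recursion. *)
Lemma GammaS x : 1 <= x -> Gamma (x + 1) = x * Gamma x.
Proof.
move=> x1; rewrite /Gamma /Rintegral.
rewrite -[X in fine X]/(gamma_integral (x + 1)) gamma_integralS//.
rewrite -[X in _ = _ * fine X]/(gamma_integral x).
have : (0 <= gamma_integral x)%E.
  by apply: integral_ge0 => t _; rewrite lee_fin gamma_kernel_ge0.
case: (gamma_integral x) => [r|_|]//=; rewrite mulr0 gt0_muley//.
by rewrite lte_fin (lt_le_trans ltr01).
Qed.

Lemma gamma_integral1 : gamma_integral 1 = 1%E.
Proof.
rewrite /gamma_integral.
under eq_integral do rewrite /gamma_kernel subrr powRr0 mul1r.
rewrite integral_itv_obnd_cbnd; last first.
  apply/measurable_EFinP; apply: measurable_funTS.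
  by apply: continuous_measurable_fun => t; exact: continuous_expRN.
have dG t : is_derive t 1 (fun t : R => - expR (- t)) (expR (- t)).
  have D : is_derive t 1 (expR \o -%R) (expR (- t) * -1) by exact: is_derive1_comp.
  by apply: is_derive_eq; rewrite mulrN1 opprK.
rewrite (@ge0_continuous_FTC2y R (fun t => expR (- t)) (fun t => - expR (- t)) 0 0).
- by rewrite oppr0 expR0 sub0e EFinN oppeK.
- by move=> t _; exact: expR_ge0.
- by apply: continuous_subspaceT => t; exact: continuous_expRN.
- by rewrite -oppr0; apply: cvgN; exact: cvgr_expR.
- by move=> t _; exact: (@ex_derive _ _ _ _ _ _ _ (dG t)).
- by apply: cvg_at_right_filter; apply: cvgN; exact: continuous_expRN.
- by move=> t _; rewrite derive1E (@derive_val _ _ _ _ _ _ _ (dG t)).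
Qed.

Lemma gamma_integral_nat n : (gamma_integral n.+1%:R < +oo)%E.
Proof.
elim: n => [|n ih]; first by rewrite gamma_integral1 ltry.
rewrite -[X in gamma_integral X]natr1 gamma_integralS ?ler1n//.
by apply: lte_mul_pinfty => //; rewrite lee_fin.
Qed.

(** For [t <= 1] the kernel is below the kernel of 1, for [t > 1] below the kernel of an integer
    [N + 1 >= x]; both of these have finite integrals. *)
Lemma gamma_integral_lty x : 1 <= x -> (gamma_integral x < +oo)%E.
Proof.
move=> x1; have [N xN] : exists N : nat, x - 1 <= N%:R.
  exists (Num.bound x); rewrite (@le_trans _ _ x)//; first lra.
  by apply/ltW/archi_boundP; rewrite (le_trans ler01 x1).
apply: (@le_lt_trans _ _ (gamma_integral 1 + gamma_integral N.+1%:R)%E); last first.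
  have h1 : (gamma_integral 1 < +oo)%E by rewrite gamma_integral1 ltry.
  exact: lte_add_pinfty h1 (gamma_integral_nat N).
have mk (y : R) : measurable_fun (`]0, +oo[ : set R) (EFin \o gamma_kernel y).
  by apply/measurable_EFinP; exact: measurable_gamma_kernel.
rewrite /gamma_integral -ge0_integralD//=; try exact: mk;
  try by move=> t _; rewrite lee_fin gamma_kernel_ge0.
apply: ge0_le_integral => //=;
  try exact: mk; try by move=> t _; rewrite lee_fin gamma_kernel_ge0.
  by apply: emeasurable_funD; exact: mk.
move=> t; rewrite in_itv/= andbT => t0.
rewrite -EFinD lee_fin -mulrDl ler_wpM2r ?expR_ge0// subrr powRr0.
rewrite -[N.+1%:R]natr1 addrK.
have [t1|t1] := leP t 1.
  have : t `^ (x - 1) <= t `^ 0 by apply: ger_powR; rewrite ?t0 ?subr_ge0.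
  by rewrite powRr0 => tx; rewrite ler_wpDr ?powR_ge0.
by rewrite ler_wpDl// ler_powR// ltW.
Qed.

(** Finiteness matters as much as the lower bound on ]1, 2[, because [fine] would send an infinite
    integral to 0. *)
Lemma Gamma_gt0 x : 1 <= x -> 0 < Gamma x.
Proof.
move=> x1; rewrite /Gamma /Rintegral -[X in fine X]/(gamma_integral x).
apply: fine_gt0; rewrite gamma_integral_lty// andbT.
have mk (y : R) : measurable_fun (`]0, +oo[ : set R) (EFin \o gamma_kernel y).
  by apply/measurable_EFinP; exact: measurable_gamma_kernel.
have sub : `]1%R, 2%R[%classic `<=` (`]0%R, +oo[%classic : set R).
  by move=> t; rewrite /= !in_itv/= andbT => /andP[t1 _]; rewrite (lt_trans _ t1).
apply: (@lt_le_trans _ _ (\int[leb]_(t in `]1%R, 2%R[) (expR (- 2))%:E)%E).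
  rewrite integral_cst//= lebesgue_measure_itv/= lte_fin ltr1n/= -EFinB -EFinM lte_fin.
  by rewrite mulr_gt0 ?expR_gt0//; lra.
apply: (@le_trans _ _ (\int[leb]_(t in `]1%R, 2%R[) (gamma_kernel x t)%:E)%E).
  apply: ge0_le_integral => //=; try exact: (measurable_funS _ sub (mk x));
    try by move=> t _; rewrite lee_fin ?expR_ge0 ?gamma_kernel_ge0.
  move=> t; rewrite in_itv/= => /andP[t1 t2]; rewrite lee_fin.
  rewrite -[leLHS]mul1r ler_pM ?expR_ge0//; last by rewrite ler_expR lerN2 ltW.
  have : t `^ 0 <= t `^ (x - 1) by apply: ler_powR; [exact: ltW|rewrite subr_ge0].
  by rewrite powRr0.
apply: ge0_subset_integral => //=; first exact: mk.
by move=> t _; rewrite lee_fin gamma_kernel_ge0.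
Qed.

End gamma_function.

(** * The normalized Bessel function as an entire function of the squared argument *)

Section bessel_function.
Context {R : realType}.
Implicit Types (x nu : R) (c : nat -> R).

Lemma is_cvg_pseries_fact c x : (forall k, `|c k| <= k`!%:R^-1) -> cvgn (pseries c x).
Proof.
move=> cf; apply: normed_cvg.
apply: (@series_le_cvg _ _ (exp_coeff `|x|)) => [k|k|k|].
- exact: normr_ge0.
- by rewrite exp_coeff_ge0.
- by rewrite /exp_coeff /= normrM normrX mulrC ler_wpM2l ?exprn_ge0.
- exact: is_cvg_series_exp_coeff.
Qed.

(** Since [(k + 1) / (k + 1)! = 1 / k!], the bound survives termwise differentiation, and all
    derived series converge everywhere. *)
Lemma pseries_diffs_fact c : (forall k, `|c k| <= k`!%:R^-1) ->
  forall k, `|pseries_diffs c k| <= k`!%:R^-1.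
Proof.
move=> cf k; rewrite /pseries_diffs normrM normr_nat.
rewrite (le_trans (ler_wpM2l (ler0n _ _) (cf k.+1)))//.
by rewrite factS natrM invfM mulVKf.
Qed.

Lemma is_derive_pseries_fact c x : (forall k, `|c k| <= k`!%:R^-1) ->
  is_derive x 1 (fun x => limn (pseries c x)) (limn (pseries (pseries_diffs c) x)).
Proof.
move=> cf; have d1 := pseries_diffs_fact cf.
apply: (@pseries_snd_diffs _ c (`|x| + 1)); try exact: is_cvg_pseries_fact.
- by apply: is_cvg_pseries_fact; exact: pseries_diffs_fact.
- by rewrite [ltRHS]ger0_norm ?addr_ge0// ltrDl.
Qed.

Definition bessel_coef nu (k : nat) : R :=
  (-1) ^+ k * Gamma (nu + 1) / (k`!%:R * Gamma (k%:R + nu + 1) * 4 ^+ k).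

(* [normalized_besselJ nu x] is this entire function at [x ^+ 2]. *)
Definition bessel_series nu x : R := limn (pseries (bessel_coef nu) x).

Definition bessel_series' nu x : R := limn (pseries (pseries_diffs (bessel_coef nu)) x).

Definition bessel_series'' nu x : R :=
  limn (pseries (pseries_diffs (pseries_diffs (bessel_coef nu))) x).

Variable nu : R.
Hypothesis nu0 : 0 <= nu.

Let Gamma_neq0 (k : nat) : Gamma (k%:R + nu + 1) != 0.
Proof. by rewrite gt_eqF// Gamma_gt0// lerDr addr_ge0. Qed.

Lemma bessel_coef0 : bessel_coef nu 0 = 1.
Proof.
rewrite /bessel_coef !expr0 fact0 !mul1r add0r mulr1 divff//.
by have := Gamma_neq0 0; rewrite add0r.
Qed.

(** The Bessel equation coefficient by coefficient, obtained from the recursion of Gamma. *)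
Lemma bessel_coefS k :
  4 * k.+1%:R * (k%:R + nu + 1) * bessel_coef nu k.+1 = - bessel_coef nu k.
Proof.
rewrite /bessel_coef; have -> : k.+1%:R + nu + 1 = (k%:R + nu + 1) + 1.
  by rewrite -natr1; ring.
rewrite [Gamma (k%:R + nu + 1 + 1)]GammaS; last by rewrite lerDr addr_ge0.
rewrite factS natrM !exprS.
have := Gamma_neq0 k; have kn : k%:R + nu + 1 != 0 by rewrite gt_eqF// ltr_wpDl// addr_ge0.
have k1 : 1 + k%:R != 0 :> R by rewrite addrC natr1 pnatr_eq0.
have k4 : (4 : R) ^+ k != 0 by rewrite expf_neq0// pnatr_eq0.
move=> G0; field.
by rewrite G0 kn k1 k4 pnatr_eq0 -lt0n fact_gt0.
Qed.

(** Each step of the recursion divides by [4 (k + 1) (k + nu + 1)], which is at least [k + 1]. *)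
Lemma bessel_coef_fact k : `|bessel_coef nu k| <= k`!%:R^-1.
Proof.
elim: k => [|k ih]; first by rewrite bessel_coef0 fact0 normr1 invr1.
have p0 : 0 < 4 * k.+1%:R * (k%:R + nu + 1) by rewrite !mulr_gt0// ltr_wpDl// addr_ge0.
have -> : bessel_coef nu k.+1 =
    - bessel_coef nu k / (4 * k.+1%:R * (k%:R + nu + 1)).
  by rewrite -bessel_coefS mulrC mulrA mulVf ?mul1r// gt_eqF.
rewrite normrM normrN normfV (gtr0_norm p0) factS natrM [in leRHS]mulrC.
rewrite [leRHS]invfM ler_pM ?invr_ge0 ?(ltW p0)//.
rewrite lef_pV2 ?posrE// -mulrA mulrCA ler_peMr//.
have k0 : 0 <= k%:R :> R by [].
by rewrite mulrDr mulr1; have := nu0; nra.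
Qed.

Lemma is_derive_bessel_series x :
  is_derive x 1 (bessel_series nu) (bessel_series' nu x).
Proof. exact: is_derive_pseries_fact bessel_coef_fact. Qed.

Lemma is_derive_bessel_series' x :
  is_derive x 1 (bessel_series' nu) (bessel_series'' nu x).
Proof.
by apply: is_derive_pseries_fact; apply: pseries_diffs_fact; exact: bessel_coef_fact.
Qed.

Lemma bessel_series0 : bessel_series nu 0 = 1.
Proof.
apply: cvg_lim => //; rewrite -(cvg_shiftS (pseries _ _)).
under eq_fun => k.
  rewrite /pseries /series /= big_nat_recl// expr0 mulr1 bessel_coef0.
  rewrite big1 ?addr0 => [|i _]; last by rewrite exprS mul0r mulr0.
  over.
exact: cvg_cst.
Qed.

(** For [F (|t|^2)] on R^n the Laplacian is [4 x F'' + 2 n F'] at [x = |t|^2]. With [2 (nu + 1) = n]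
    this is therefore [Delta f = - f], proved here on partial sums. *)
Lemma bessel_ode x :
  4 * x * bessel_series'' nu x + 4 * (nu + 1) * bessel_series' nu x =
  - bessel_series nu x.
Proof.
have f0 := bessel_coef_fact; have f1 := pseries_diffs_fact f0.
have L0 : pseries (bessel_coef nu) x @ \oo --> bessel_series nu x.
  exact: is_cvg_pseries_fact.
have L1 : pseries (pseries_diffs (bessel_coef nu)) x @ \oo --> bessel_series' nu x.
  exact: is_cvg_pseries_fact.
(* In this indexing the second derivative has terms in [i x^(i - 1)], so multiplying by [x] aligns
   its powers with the other two series; the term [i = 0] vanishes. *)
have L2 := pseries_diffs_equiv (@is_cvg_pseries_fact _ x (pseries_diffs_fact f1)).
set u := series _ in L2.
have L3 : 4 * x * u k + 4 * (nu + 1) * pseries (pseries_diffs (bessel_coef nu)) x k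
    @[k --> \oo] --> 4 * x * bessel_series'' nu x + 4 * (nu + 1) * bessel_series' nu x.
  by apply: cvgD; apply: cvgM => //; exact: cvg_cst.
have L4 : - pseries (bessel_coef nu) x k @[k --> \oo] --> - bessel_series nu x.
  exact: cvgN.
rewrite (_ : (fun k => _) = fun k => - pseries (bessel_coef nu) x k) in L3.
  exact: (cvg_unique _ L3 L4).
apply/funext => k; rewrite /u /pseries /series /= !mulr_sumr -big_split /= -sumrN.
apply: eq_bigr => i _; rewrite -mulNr -bessel_coefS /pseries_diffs.
by case: i => [|i]; rewrite /= ?expr0 ?exprS -?natr1; ring.
Qed.

Lemma normalized_besselJE x : 0 <= x ->
  normalized_besselJ nu x = bessel_series nu (x ^+ 2).
Proof.
rewrite /normalized_besselJ; have [->|x0 xge0] := eqVneq x 0.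
  by rewrite expr0n bessel_series0.
have {x0 xge0} x0 : 0 < x by rewrite lt_neqAle eq_sym x0.
have K0 : Gamma (nu + 1) * (2 / x) `^ nu != 0.
  rewrite mulf_neq0//; first by have := Gamma_neq0 0; rewrite add0r.
  by rewrite gt_eqF// powR_gt0// divr_gt0.
(* The prefactor moves to the side whose series is known to converge; this also yields the
   convergence of the series defining [besselJ]. *)
apply: (mulfI (invr_neq0 K0)); rewrite mulKf//.
apply: cvg_lim => //.
have L0 : pseries (bessel_coef nu) (x ^+ 2) @ \oo --> bessel_series nu (x ^+ 2).
  by apply: is_cvg_pseries_fact; exact: bessel_coef_fact.
have : (Gamma (nu + 1) * (2 / x) `^ nu)^-1 * pseries (bessel_coef nu) (x ^+ 2) k
    @[k --> \oo] --> (Gamma (nu + 1) * (2 / x) `^ nu)^-1 * bessel_series nu (x ^+ 2).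
  by apply: cvgM => //; exact: cvg_cst.
apply: cvg_trans; apply: near_eq_cvg; apply: nearW => k.
rewrite /pseries /series /= mulr_sumr; apply: eq_bigr => i _.
rewrite /bessel_coef powRD; last by apply/implyP => _; rewrite gt_eqF// divr_gt0.
rewrite powRrM powR_mulrn ?ltW ?divr_gt0// (_ : 2 = 2%:R :> R)// powR_mulrn ?ltW ?exprn_gt0 ?divr_gt0//.
have -> : x / 2 = (2 / x)^-1 by rewrite invf_div.
have p0 : 0 < 2 / x by rewrite divr_gt0.
have -> : (2 / x)^-1 `^ nu = ((2 / x) `^ nu)^-1 by rewrite -powR_inv1 ?ltW// powRAC powR_inv1 ?powR_ge0.
have q0 : (2 / x) `^ nu != 0 by rewrite gt_eqF// powR_gt0.
have G0 := Gamma_neq0 i; have G00 := Gamma_neq0 0; rewrite add0r in G00.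
have -> : (4 : R) ^+ i = 2 ^+ i * 2 ^+ i by rewrite -exprMn; congr (_ ^+ _); ring.
have -> : (((2 / x)^-1) ^+ 2) ^+ i = x ^+ i * x ^+ i / (2 ^+ i * 2 ^+ i).
  by rewrite invf_div -!exprMn -exprVn -exprMn; congr (_ ^+ _); field.
rewrite [x ^+ 2 ^+ i]exprAC expr2.
have i2 : (2 : R) ^+ i != 0 by rewrite expf_neq0// pnatr_eq0.
field.
by rewrite q0 G0 G00 i2 pnatr_eq0 -lt0n fact_gt0.
Qed.

End bessel_function.

(** * The law mu_alpha *)

Section dot_lemmas.
Context {R : realType} {n : nat}.
Implicit Types t y : n.-tuple R.

Lemma dotC t y : dot t y = dot y t.
Proof. by apply: eq_bigr => i _; rewrite mulrC. Qed.

Lemma dotvv_ge0 t : 0 <= dot t t.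
Proof. by apply: sumr_ge0 => i _; rewrite -expr2 sqr_ge0. Qed.

Lemma sqr_norm2 t : norm2 t ^+ 2 = dot t t.
Proof. by rewrite sqr_sqrtr// dotvv_ge0. Qed.

Lemma dotvv_shift_coord t i s : dot (shift_coord t i s) (shift_coord t i s) =
  dot t t + s * (2 * tnth t i) + s ^+ 2.
Proof.
rewrite dot_shift_coord dotC dot_shift_coord tnth_shift_coord eqxx mulr1n; ring.
Qed.

Lemma is_derive_dotvv_shift_coord t i :
  is_derive (0 : R) 1
    (fun s => dot (shift_coord t i s) (shift_coord t i s)) (2 * tnth t i).
Proof.
rewrite (_ : (fun s => _) =
  cst (dot t t) + (2 * tnth t i) \*: (id : R -> R) + (id : R -> R) ^+ 2); last first.
  by apply/funext => s; rewrite dotvv_shift_coord [s * _]mulrC.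
have D1 := is_deriveZ (2 * tnth t i) (is_derive_id (0 : R) 1).
have D2 := is_deriveX 2 (is_derive_id (0 : R) 1).
have D0 := is_derive_cst (dot t t) (0 : R) (1 : R).
apply: (is_derive_eq (is_deriveD (is_deriveD D0 D1) D2)).
by rewrite /GRing.scale /= expr1 !mulr0 mul0r mulr1 add0r addr0.
Qed.

Lemma shift_coord0 t i : shift_coord t i 0 = t.
Proof.
by apply: eq_from_tnth => j; rewrite tnth_shift_coord mul0rn addr0.
Qed.

(* Expand the product over [i] of [exp (c y_i) + exp (- c y_i)], each factor of
   which dominates [exp (c |y_i|)]. *)
Lemma expR_l1norm_le (c : R) y : 0 <= c ->
  expR (c * l1norm y) <= \sum_(f : {ffun 'I_n -> bool})
    expR (dot [tuple (if f i then c else - c) | i < n] y).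
Proof.
move=> c0; rewrite mulr_sumr expR_sum.
apply: (@le_trans _ _ (\prod_(i < n) \sum_(b : bool)
    expR ((if b then c else - c) * tnth y i))).
  apply: ler_prod => i _; rewrite expR_ge0 big_bool /=.
  have [y0|y0] := leP 0 (tnth y i).
    by rewrite ger0_norm// lerDl expR_ge0.
  by rewrite ltr0_norm// mulrN mulNr lerDr expR_ge0.
rewrite bigA_distr_bigA /= le_eqVlt; apply/orP; left; apply/eqP.
apply: eq_bigr => f _; rewrite -expR_sum; congr expR.
by apply: eq_bigr => i _; rewrite tnth_mktuple.
Qed.

End dot_lemmas.

(** * First and second derivatives of the transform of mu_alpha *)

Section bessel_laplace.
Context {R : realType} {n : nat}.
Variables (nu alpha r : R) (mua : probability (n.-tuple R) R).
Hypotheses (nuE : 2 * (nu + 1) = n%:R) (nu0 : 0 <= nu) (alpha0 : 0 < alpha).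
Hypothesis r0 : 0 < r.
Implicit Types t y : n.-tuple R.
Let box t := forall i, `|tnth t i| < r.
Hypothesis series_gt0 : forall t, box t -> 0 < bessel_series nu (dot t t).
Hypothesis laplaceE : forall t, box t -> (\int[mua]_y (expR (dot t y))%:E =
  (bessel_series nu (dot t t) `^ (- alpha))%:E)%E.

Lemma integrable_expR_dot t : box t ->
  mua.-integrable [set: n.-tuple R] (fun y => (expR (dot t y))%:E).
Proof.
move=> bt; apply/integrableP; split.
  apply/measurable_EFinP; apply: measurableT_comp => //; exact: measurable_dot.
under eq_integral do rewrite /= ger0_norm ?expR_ge0//.
by rewrite laplaceE// ltry.
Qed.

(** The sign vectors with entries [r / 2] or [- r / 2] lie strictly inside the box where the
    transform is finite, and their exponentials dominate that of the l1 norm. *)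
Lemma exp_integrable_half : exp_integrable mua (fun=> 1) id (r / 2).
Proof.
split => //; first by rewrite divr_gt0.
pose S y := \sum_(f : {ffun 'I_n -> bool})
    expR (dot [tuple (if f i then r / 2 else - (r / 2)) | i < n] y).
apply: (@le_integrable _ _ _ mua setT measurableT _ (EFin \o S)).
- apply/measurable_EFinP; apply: measurable_funM => //.
  apply: measurableT_comp => //; apply: measurable_funM => //.
  exact: measurable_l1norm.
- move=> y _; rewrite /= lee_fin mul1r ger0_norm ?expR_ge0//.
  rewrite (le_trans _ (ler_norm _))// expR_l1norm_le// ltW// divr_gt0//.
- rewrite (_ : EFin \o S = (fun y => \sum_(f : {ffun 'I_n -> bool})
    (expR (dot [tuple (if f i then r / 2 else - (r / 2)) | i < n] y))%:E)%E).
    apply: integrable_sum => // f _; apply: integrable_expR_dot => i.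
    rewrite tnth_mktuple; have -> : `|if f i then r / 2 else - (r / 2)| = r / 2.
      by case: (f i); rewrite ?normrN ger0_norm// ltW// divr_gt0.
    by have := r0; lra.
  by apply/funext => y; rewrite /= /S sumEFin.
Qed.

Let F : R -> R := bessel_series nu.
Let F1 : R -> R := bessel_series' nu.
Let F2 : R -> R := bessel_series'' nu.
Let small t := forall i, `|tnth t i| < r / 2.

Let small_box t : small t -> box t.
Proof. by move=> st i; have := st i; have := r0; lra. Qed.

Definition laplace t := \int[mua]_y expR (dot t y).
Definition laplace1 i t := \int[mua]_y (tnth y i * expR (dot t y)).
Definition laplace2 i t := \int[mua]_y (tnth y i ^+ 2 * expR (dot t y)).

Lemma laplace_besselE t : box t -> laplace t = F (dot t t) `^ (- alpha).
Proof. by move=> bt; rewrite /laplace /Rintegral laplaceE. Qed.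

Let is_derive_F_shift t i :
  is_derive (0 : R) 1 (fun s => F (dot (shift_coord t i s) (shift_coord t i s)))
    (F1 (dot t t) * (2 * tnth t i)).
Proof.
have D := is_derive_dotvv_shift_coord t i.
apply: (@is_derive1_comp _ F (fun s => dot (shift_coord t i s) (shift_coord t i s))) => //.
by rewrite shift_coord0; exact: is_derive_bessel_series.
Qed.

Let is_derive_F1_shift t i :
  is_derive (0 : R) 1 (fun s => F1 (dot (shift_coord t i s) (shift_coord t i s)))
    (F2 (dot t t) * (2 * tnth t i)).
Proof.
have D := is_derive_dotvv_shift_coord t i.
apply: (@is_derive1_comp _ F1 (fun s => dot (shift_coord t i s) (shift_coord t i s))) => //.
by rewrite shift_coord0; exact: is_derive_bessel_series'.
Qed.

Let is_derive_powF_shift p t i : box t ->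
  is_derive (0 : R) 1 (fun s => F (dot (shift_coord t i s) (shift_coord t i s)) `^ p)
    (p * F (dot t t) `^ (p - 1) * (F1 (dot t t) * (2 * tnth t i))).
Proof.
move=> bt; have D := is_derive_F_shift t i.
pose g s := F (dot (shift_coord t i s) (shift_coord t i s)).
have D0 : is_derive (g 0) 1 (fun x => x `^ p) (p * F (dot t t) `^ (p - 1)).
  by rewrite /g shift_coord0; apply: is_derive1_powR; exact: series_gt0.
exact: (@is_derive1_comp _ (fun x => x `^ p) g 0 _ _ D0 D).
Qed.

(** The partial derivative is computed twice, under the integral sign and by the chain rule on
    [F (|t|^2)^(- alpha)]; positivity of [F] on the box makes the power differentiable. *)
Lemma laplace1E i t : small t ->
  laplace1 i t = - alpha * F (dot t t) `^ (- alpha - 1) * (F1 (dot t t) * (2 * tnth t i)).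
Proof.
move=> st; have s1 : subexponential (cst 1 : n.-tuple R -> R) by exact: subexponential_cst.
have D1 := is_derive_laplace exp_integrable_half i s1 st.
have D2 := is_derive_powF_shift (- alpha) i (small_box st).
rewrite -(@derive_val _ _ _ _ _ _ _ D2).
transitivity (\int[mua]_y (1 * (tnth (id y) i * cst 1 (id y) * expR (dot t (id y))))).
  by apply: eq_Rintegral => y _; rewrite /= mul1r mulr1.
rewrite -(@derive_val _ _ _ _ _ _ _ D1); apply: near_eq_derive.
have rp : 0 < r / 2 by rewrite divr_gt0.
near=> s; rewrite -laplace_besselE.
  by apply: eq_Rintegral => y _; rewrite /= !mul1r.
apply: small_box; near: s; exact: near_shift_coord_box.
Unshelve. all: by end_near. Qed.

Lemma laplace2E i t : small t ->
  laplace2 i t = - alpha *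
   ((- alpha - 1) * F (dot t t) `^ (- alpha - 1 - 1) * (F1 (dot t t) * (2 * tnth t i)) *
      (F1 (dot t t) * (2 * tnth t i)) +
    F (dot t t) `^ (- alpha - 1) *
      (F2 (dot t t) * (2 * tnth t i) * (2 * tnth t i) + F1 (dot t t) * 2)).
Proof.
move=> st; have s1 := subexponential_tnth (R := R) i.
have D1 := is_derive_laplace exp_integrable_half i s1 st.
have D2 := is_derive_powF_shift (- alpha - 1) i (small_box st).
have D3 := is_derive_F1_shift t i.
have D4 : is_derive (0 : R) 1 (fun s => 2 * tnth (shift_coord t i s) i) (2 : R).
  rewrite (_ : (fun s => _) = cst (2 * tnth t i) + 2 \*: (id : R -> R)).
    have D0 := is_derive_cst (2 * tnth t i) (0 : R) (1 : R).
    apply: (is_derive_eq (is_deriveD D0 (is_deriveZ 2 (is_derive_id (0 : R) 1)))).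
    by rewrite /GRing.scale /= mulr1 add0r.
  by apply/funext => s; rewrite tnth_shift_coord eqxx mulr1n mulrDr.
have D := is_deriveZ (- alpha) (is_deriveM D2 (is_deriveM D3 D4)).
transitivity (\int[mua]_y (1 * (tnth (id y) i * tnth (id y) i * expR (dot t (id y))))).
  by apply: eq_Rintegral => y _; rewrite /= mul1r expr2.
rewrite -(@derive_val _ _ _ _ _ _ _ D1).
transitivity (- alpha *: (F (dot t t) `^ (- alpha - 1) *:
   (F1 (dot t t) *: 2 + (2 * tnth t i) *: (F2 (dot t t) * (2 * tnth t i))) +
   (F1 (dot t t) * (2 * tnth t i)) *:
     ((- alpha - 1) * F (dot t t) `^ (- alpha - 1 - 1) * (F1 (dot t t) * (2 * tnth t i)))));
  last by rewrite /GRing.scale /=; ring.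
have := @derive_val _ _ _ _ _ _ _ D; rewrite !fctE !shift_coord0 => <-.
apply: near_eq_derive.
have rp : 0 < r / 2 by rewrite divr_gt0.
near=> s; transitivity (laplace1 i (shift_coord t i s)).
  by apply: eq_Rintegral => y _; rewrite /= mul1r.
rewrite laplace1E; first by rewrite -mulrA.
near: s; exact: near_shift_coord_box.
Unshelve. all: by end_near. Qed.

(* [L Delta L = alpha L^2 + (1 + 1 / alpha) |grad L|^2] for
   [L = f ^ (- alpha)] with [Delta f = - f]. *)
Lemma laplace_identity t : small t ->
  laplace t * (\sum_(i < n) laplace2 i t) =
  alpha * laplace t ^+ 2 + (1 + alpha^-1) * \sum_(i < n) laplace1 i t ^+ 2.
Proof.
move=> st; have Fp := series_gt0 (small_box st).
rewrite laplace_besselE; last exact: small_box.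
under eq_bigr do rewrite laplace2E//.
under [in RHS]eq_bigr do rewrite laplace1E//.
have ode := bessel_ode nu0 (dot t t); rewrite -/F -/F1 -/F2 in ode Fp *.
set s := dot t t in ode Fp *.
(* Writing every power of [F] as a multiple of the lowest one turns the goal into a polynomial
   identity. *)
set p := F s `^ (- alpha - 1 - 1).
have powS q : F s `^ q = F s * F s `^ (q - 1).
  have /(@powRD R (F s)) : (q - 1 + 1 == 0) ==> (F s != 0).
    by apply/implyP => _; rewrite gt_eqF.
  by rewrite subrK => ->; rewrite powRr1 ?ltW// mulrC.
have p1 : F s `^ (- alpha - 1) = F s * p by exact: powS.
have p2 : F s `^ (- alpha) = F s * (F s * p) by rewrite powS p1.
rewrite p1 p2.
have sE : \sum_(i < n) tnth t i ^+ 2 = s by apply: eq_bigr => i _; rewrite expr2.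
rewrite (_ : \sum_(i < n) _ = - alpha * ((- alpha - 1) * p * F1 s ^+ 2 * 4 * s +
   F s * p * (4 * s * F2 s + 4 * (nu + 1) * F1 s))); last first.
  (* Here the dimension meets the order of the Bessel function: the [n] contributions [2 F'] add up
     to the first-order term of [bessel_ode]. *)
  have nE : 4 * (nu + 1) = 2 * n%:R by rewrite -nuE; ring.
  rewrite nE -mulr_sumr; congr (_ * _).
  rewrite big_split /= -mulr_sumr big_split /=.
  rewrite sumr_const card_ord -[_ *+ n]mulr_natr -sE.
  have -> : (- alpha - 1) * p * F1 s ^+ 2 * 4 * \sum_(i < n) tnth t i ^+ 2 =
    \sum_(i < n) (- alpha - 1) * p * (F1 s * (2 * tnth t i)) * (F1 s * (2 * tnth t i)).
    by rewrite mulr_sumr; apply: eq_bigr => i _; ring.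
  congr (_ + _ * _); congr (_ + _); last by ring.
  have -> : 4 * (\sum_(i < n) tnth t i ^+ 2) * F2 s =
    (4 * F2 s) * \sum_(i < n) tnth t i ^+ 2 by ring.
  by rewrite mulr_sumr; apply: eq_bigr => i _; ring.
rewrite ode.
rewrite [in RHS](_ : \sum_(i < n) _ = alpha ^+ 2 * (F s * p) ^+ 2 * F1 s ^+ 2 * 4 * s); last first.
  by rewrite -sE mulr_sumr; apply: eq_bigr => i _; ring.
by field; rewrite gt_eqF.
Qed.

End bessel_laplace.

(** * Factorization of integrals over a product measure *)

Section product_integrals.
Context {R : realType} {d1 d2} {T1 : measurableType d1} {T2 : measurableType d2}.
Variables (m1 : {sigma_finite_measure set T1 -> \bar R}).
Variables (m2 : {sigma_finite_measure set T2 -> \bar R}).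
Variables (a : T1 -> R) (b : T2 -> R).
Hypotheses (ia : m1.-integrable setT (EFin \o a)) (ib : m2.-integrable setT (EFin \o b)).

Lemma integrable_prod_mul :
  (m1 \x m2)%E.-integrable setT (EFin \o (fun z => a z.1 * b z.2)).
Proof.
have ma : measurable_fun setT a by apply/measurable_EFinP; exact: measurable_int ia.
have mb : measurable_fun setT b by apply/measurable_EFinP; exact: measurable_int ib.
apply/integrable12ltyP.
  apply/measurable_EFinP; apply: measurable_funM.
    exact: (measurableT_comp ma measurable_fst).
  exact: (measurableT_comp mb measurable_snd).
have /integrableP[_ lb] := ib; have /integrableP[_ la] := ia.
have B0 : (0 <= \int[m2]_y `|(EFin \o b) y|)%E by exact: integral_ge0.
rewrite (_ : (\int[m1]_x _)%E =
  (\int[m1]_x (\int[m2]_y `|(EFin \o b) y| * `|(EFin \o a) x|))%E).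
  rewrite ge0_integralZl//.
    by apply: lte_mul_pinfty => //; rewrite ge0_fin_numE.
  by apply: measurableT_comp => //; exact/measurable_EFinP.
apply: eq_integral => x _.
rewrite muleC -ge0_integralZl//; last first.
  by apply: measurableT_comp => //; exact/measurable_EFinP.
by apply: eq_integral => y _; rewrite /= normrM EFinM.
Qed.

Lemma Rintegral_prod_mul : \int[(m1 \x m2)%E]_z (a z.1 * b z.2) =
  (\int[m1]_x a x) * (\int[m2]_y b y).
Proof.
rewrite /Rintegral -(integral12_prod_meas1 integrable_prod_mul) /fubini_F /=.
under eq_integral => x _.
  under eq_integral do rewrite EFinM.
  rewrite integralZl// -[X in (_ * X)%E]fineK ?integrable_fin_num// muleC.
  over.
by rewrite integralZl// fineM ?integrable_fin_num// mulrC.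
Qed.

End product_integrals.

Section Rintegral_sum.
Context {R : realType} {d} {T : measurableType d} (m : {measure set T -> \bar R}).

Lemma Rintegral_sum (I : Type) (s : seq I) (f : I -> T -> R) :
  (forall i, m.-integrable setT (EFin \o f i)) ->
  \int[m]_x (\sum_(i <- s) f i x) = \sum_(i <- s) \int[m]_x f i x.
Proof.
move=> fi; elim: s => [|i s ih].
  rewrite big_nil; under eq_Rintegral do rewrite big_nil.
  by rewrite /Rintegral integral0.
rewrite big_cons -ih -RintegralD//.
  by apply: eq_Rintegral => x _; rewrite big_cons.
rewrite (_ : EFin \o _ = (fun x => \sum_(i <- s) (f i x)%:E)%E).
  by apply: integrable_sum => // j _; exact: fi.
by apply/funext => x; rewrite /= sumEFin.
Qed.

End Rintegral_sum.

(** * The scalar conditional identity for two independent copies *)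

Section convolution.
Context {R : realType} {n : nat}.
Variables (nu alpha r : R) (mua : probability (n.-tuple R) R).
Hypotheses (nuE : 2 * (nu + 1) = n%:R) (nu0 : 0 <= nu) (alpha0 : 0 < alpha).
Hypothesis r0 : 0 < r.
Implicit Types t x y : n.-tuple R.
Hypothesis series_gt0 : forall t, (forall i, `|tnth t i| < r) ->
  0 < bessel_series nu (dot t t).
Hypothesis laplaceE : forall t, (forall i, `|tnth t i| < r) ->
  (\int[mua]_y (expR (dot t y))%:E =
  (bessel_series nu (dot t t) `^ (- alpha))%:E)%E.

Definition tuple_add x y : n.-tuple R := [tuple tnth x i + tnth y i | i < n].

(** The squared length of [x + c y]: taking [c = -1] and [c = 1] lets one computation serve the
    difference and the sum. *)
Definition sqdist (c : R) (z : n.-tuple R * n.-tuple R) : R :=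
  \sum_(i < n) (tnth z.1 i + c * tnth z.2 i) ^+ 2.

Lemma dot_tuple_add t x y : dot t (tuple_add x y) = dot t x + dot t y.
Proof.
by rewrite -big_split; apply: eq_bigr => i _; rewrite /= tnth_mktuple mulrDr.
Qed.

Lemma measurable_tuple_add :
  measurable_fun setT (fun z : n.-tuple R * n.-tuple R => tuple_add z.1 z.2).
Proof.
apply/measurable_fun_tnthP => i.
rewrite (_ : _ \o _ = fun z => tnth z.1 i + tnth z.2 i); last first.
  by apply/funext => z; rewrite /= tnth_mktuple.
apply: measurable_funD.
  exact: (measurableT_comp (measurable_tnth i) measurable_fst).
exact: (measurableT_comp (measurable_tnth i) measurable_snd).
Qed.

Lemma measurable_sqdist c : measurable_fun setT (sqdist c).
Proof.
apply: measurable_sum => i; apply: measurable_funX; apply: measurable_funD.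
  exact: (measurableT_comp (measurable_tnth i) measurable_fst).
apply: measurable_funM => //.
exact: (measurableT_comp (measurable_tnth i) measurable_snd).
Qed.

Lemma sqdist_le c x y : `|c| <= 1 ->
  `|sqdist c (x, y)| <= n%:R * (l1norm x + l1norm y) ^+ 2.
Proof.
move=> c1; rewrite ger0_norm; last by apply: sumr_ge0 => i _; exact: sqr_ge0.
rewrite -[n in n%:R]card_ord mulr_natl -sumr_const; apply: ler_sum => i _ /=.
rewrite -[leLHS]real_normK ?num_real// ler_pXn2r// ?nnegrE ?addr_ge0 ?l1norm_ge0//.
rewrite (le_trans (ler_normD _ _))// lerD ?normr_tnth_le_l1norm// normrM.
by rewrite (le_trans _ (normr_tnth_le_l1norm y i))// ler_piMl.
Qed.

Lemma l1norm_tuple_add x y : l1norm (tuple_add x y) <= l1norm x + l1norm y.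
Proof.
rewrite -big_split; apply: ler_sum => i _.
by rewrite /= tnth_mktuple ler_normD.
Qed.

Let H := exp_integrable_half r0 laplaceE.

Let integrable_half : mua.-integrable setT (EFin \o (fun x => expR (r / 2 * l1norm x))).
Proof.
have [_ _ _] := H; apply: eq_integrable => // x _.
by rewrite /= mul1r.
Qed.

(** The rate [r / 2] available for each variable is cut into three equal parts. One pays for the
    exponential of the sum; the other two absorb the square, since [v^2 <= exp (2 v)] for
    [v = r u / 6], where [u] is the sum of the two l1 norms. *)
Lemma exp_integrable_sqdist (A C c : R) : `|c| <= 1 ->
  exp_integrable (mua \x mua)%E (fun z => A * sqdist c z + C)
    (fun z => tuple_add z.1 z.2) (r / 6).
Proof.
move=> c1; have r6 : 0 < r / 6 by rewrite divr_gt0.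
have mh : measurable_fun setT (fun z => A * sqdist c z + C).
  by apply: measurable_funD => //; apply: measurable_funM => //; exact: measurable_sqdist.
split => //; first exact: measurable_tuple_add.
pose K := `|A| * n%:R * (r / 6) ^- 2 + `|C|.
apply: (@le_integrable _ _ _ _ _ measurableT _ (fun z => (K%:E *
    (expR (r / 2 * l1norm z.1) * expR (r / 2 * l1norm z.2))%:E)%E)).
- apply/measurable_EFinP; apply: measurable_funM => //.
  apply: measurableT_comp => //; apply: measurable_funM => //.
  exact: (measurableT_comp measurable_l1norm measurable_tuple_add).
- move=> [x y] _; rewrite /= lee_fin.
  set u := l1norm x + l1norm y.
  have u0 : 0 <= u by rewrite addr_ge0 ?l1norm_ge0.
  have K0 : 0 <= K by rewrite addr_ge0// !mulr_ge0// invr_ge0 exprn_ge0// ltW.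
  rewrite [leRHS]ger0_norm ?mulr_ge0 ?expR_ge0// -expRD -mulrDr -/u.
  have -> : r / 2 * u = (r / 6 * u + r / 6 * u) + r / 6 * u by field.
  rewrite expRD mulrA normrM ler_pM//; last first.
    rewrite ger0_norm ?expR_ge0// ler_expR ler_wpM2l ?(ltW r6)//.
    exact: l1norm_tuple_add.
  have e1 : 1 <= expR (r / 6 * u + r / 6 * u).
    have ru0 : 0 <= r / 6 * u by rewrite mulr_ge0// ltW.
    by rewrite -[leLHS](@expR0 R) ler_expR; lra.
  rewrite (le_trans (ler_normD _ _))// mulrDl lerD//; last by rewrite ler_peMr.
  rewrite normrM -!mulrA ler_wpM2l// (le_trans (sqdist_le _ _ c1))// ler_wpM2l//.
  rewrite -/u -ler_pdivrMl ?invr_gt0 ?exprn_gt0// invrK -exprMn expRD -expr2.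
  rewrite ler_pXn2r ?nnegrE ?expR_ge0 ?mulr_ge0 ?(ltW r0)//.
  by rewrite [r * (_ * u)]mulrA; have := @expR_ge1Dx R (r / 6 * u); lra.
- by apply: integrableZl => //; exact: (integrable_prod_mul integrable_half integrable_half).
Qed.

Let small t := forall i, `|tnth t i| < r / 2.

Let integrable_weight g t : subexponential g -> small t ->
  mua.-integrable setT (EFin \o (fun x => g x * expR (dot t x))).
Proof.
move=> sg st; apply: eq_integrable (integrable_subexponential H sg st) => // x _.
by rewrite /= mul1r.
Qed.

Let integrable_expR t : small t -> mua.-integrable setT (EFin \o (fun x => expR (dot t x))).
Proof. by move=> st; apply: integrable_expR_dot laplaceE _ _ => i; have := st i; have := r0; lra. Qed.

(** After expanding the square, each term is a function of [x] times a function of [y]. The terms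
    [u] and [w] each give [L] times a second derivative of [L], and [v] gives the square of a first
    derivative. *)
Lemma integral_sqdist c t : small t ->
  (mua \x mua)%E.-integrable setT
    (EFin \o (fun z => sqdist c z * expR (dot t (tuple_add z.1 z.2)))) /\
  \int[(mua \x mua)%E]_z (sqdist c z * expR (dot t (tuple_add z.1 z.2))) =
  (1 + c ^+ 2) * (laplace mua t * \sum_(i < n) laplace2 mua i t) +
    2 * c * \sum_(i < n) laplace1 mua i t ^+ 2.
Proof.
move=> st.
have I0 := integrable_expR st.
have I1 i := integrable_weight (subexponential_tnth (R := R) i) st.
have I2 i : mua.-integrable setT (EFin \o (fun x => tnth x i ^+ 2 * expR (dot t x))).
  have s2 := subexponentialM (subexponential_tnth (R := R) i) (subexponential_tnth (R := R) i).
  exact: eq_integrable (integrable_weight s2 st).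
pose u i (z : n.-tuple R * n.-tuple R) :=
  tnth z.1 i ^+ 2 * expR (dot t z.1) * expR (dot t z.2).
pose v i (z : n.-tuple R * n.-tuple R) :=
  tnth z.1 i * expR (dot t z.1) * (tnth z.2 i * expR (dot t z.2)).
pose w i (z : n.-tuple R * n.-tuple R) :=
  expR (dot t z.1) * (tnth z.2 i ^+ 2 * expR (dot t z.2)).
have iu i := integrable_prod_mul (I2 i) I0.
have iv i := integrable_prod_mul (I1 i) (I1 i).
have iw i := integrable_prod_mul I0 (I2 i).
have vv i : (mua \x mua)%E.-integrable setT (EFin \o (fun z => 2 * c * v i z)).
  exact: integrableZl (iv i).
have ww i : (mua \x mua)%E.-integrable setT (EFin \o (fun z => c ^+ 2 * w i z)).
  exact: integrableZl (iw i).
have uv i : (mua \x mua)%E.-integrable setT (EFin \o (fun z => u i z + 2 * c * v i z)).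
  exact: integrableD (iu i) (vv i).
have uvw i : (mua \x mua)%E.-integrable setT
    (EFin \o (fun z => u i z + 2 * c * v i z + c ^+ 2 * w i z)).
  exact: integrableD (uv i) (ww i).
have E : (fun z => sqdist c z * expR (dot t (tuple_add z.1 z.2))) =
    (fun z => \sum_(i < n) (u i z + 2 * c * v i z + c ^+ 2 * w i z)).
  apply/funext => z; rewrite dot_tuple_add expRD mulr_suml; apply: eq_bigr => i _.
  by rewrite /u /v /w; ring.
rewrite E; split.
  rewrite (_ : EFin \o _ =
      (fun z => \sum_(i < n) (u i z + 2 * c * v i z + c ^+ 2 * w i z)%:E)%E).
    by apply: integrable_sum => // i _; exact: uvw.
  by apply/funext => z; rewrite /= sumEFin.
rewrite Rintegral_sum//.
under eq_bigr => i _.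
  rewrite (RintegralD _ (uv i) (ww i))// (RintegralD _ (iu i) (vv i))//.
  rewrite (RintegralZl _ _ (iv i))// (RintegralZl _ _ (iw i))//.
  rewrite (Rintegral_prod_mul (I2 i) I0) (Rintegral_prod_mul (I1 i) (I1 i)).
  rewrite (Rintegral_prod_mul I0 (I2 i)).
  over.
rewrite /= !mulr_sumr -big_split /=; apply: eq_bigr => i _.
by rewrite -/(laplace mua t) -/(laplace1 mua i t) -/(laplace2 mua i t); ring.
Qed.

(** Write [G = L Delta L] and [g = |grad L|^2]. The difference gives [2 (G - g)], the sum
    [2 (G + g)]. Substituting [G = alpha L^2 + (1 + 1 / alpha) g] into
    [2 (G - g) = 2 A (G + g) + C L^2], the coefficient of [g] forces [A = 1 / (1 + 2 alpha)], and
    that of [L^2] then forces [C = 2 alpha (1 - A)]. *)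
Theorem sqdist_conditional (E : set (n.-tuple R)) : measurable E ->
  \int[(mua \x mua)%E]_(z in (fun z => tuple_add z.1 z.2) @^-1` E) sqdist (-1) z =
  \int[(mua \x mua)%E]_(z in (fun z => tuple_add z.1 z.2) @^-1` E)
    (1 / (1 + 2 * alpha) * sqdist 1 z + 4 * alpha ^+ 2 / (2 * alpha + 1)).
Proof.
move=> mE; have n1 : `|-1| <= 1 :> R by rewrite normrN normr1.
have n2 : `|1| <= 1 :> R by rewrite normr1.
have E1 := exp_integrable_sqdist 1 0 n1.
have E2 := exp_integrable_sqdist (1 / (1 + 2 * alpha)) (4 * alpha ^+ 2 / (2 * alpha + 1)) n2.
rewrite -(laplace_unique E1 E2)//.
  by apply: eq_Rintegral => z _; rewrite mul1r addr0.
move=> t t6; have st : small t by move=> i; have := t6 i; have := r0; lra.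
have [i1 v1] := integral_sqdist (-1) st; have [i2 v2] := integral_sqdist 1 st.
transitivity (2 * (laplace mua t * \sum_(i < n) laplace2 mua i t) -
    2 * \sum_(i < n) laplace1 mua i t ^+ 2).
  transitivity (\int[(mua \x mua)%E]_z (sqdist (-1) z * expR (dot t (tuple_add z.1 z.2)))).
    by apply: eq_Rintegral => z _; rewrite mul1r addr0.
  by rewrite v1; ring.
have I0 := integrable_expR st.
set A := 1 / _; set C := _ / _.
transitivity (\int[(mua \x mua)%E]_z
    (A * (sqdist 1 z * expR (dot t (tuple_add z.1 z.2))) +
     C * (expR (dot t z.1) * expR (dot t z.2)))); last first.
  apply: eq_Rintegral => z _; rewrite mulrDl dot_tuple_add expRD; ring.
have ii := integrable_prod_mul I0 I0.
rewrite RintegralD//; [|exact: (integrableZl measurableT A i2)|exact: (integrableZl measurableT C ii)].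
rewrite (RintegralZl _ _ i2)// (RintegralZl _ _ ii)// v2 (Rintegral_prod_mul I0 I0).
rewrite -/(laplace mua t).
rewrite (laplace_identity nuE nu0 alpha0 r0 series_gt0 laplaceE st) /A /C.
by have := alpha0 => a0; field; do ?[apply/andP; split]; rewrite gt_eqF//; lra.
Qed.

End convolution.

(** * Invariance of mu_alpha under isometries, and its first two moments *)

Section isometry_invariance.
Context {R : realType} {n : nat}.
Variables (nu alpha r : R) (mua : probability (n.-tuple R) R).
Hypotheses (nuE : 2 * (nu + 1) = n%:R) (nu0 : 0 <= nu) (alpha0 : 0 < alpha).
Hypothesis r0 : 0 < r.
Implicit Types t x y : n.-tuple R.
Hypothesis series_gt0 : forall t, (forall i, `|tnth t i| < r) ->
  0 < bessel_series nu (dot t t).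
Hypothesis laplaceE : forall t, (forall i, `|tnth t i| < r) ->
  (\int[mua]_y (expR (dot t y))%:E =
  (bessel_series nu (dot t t) `^ (- alpha))%:E)%E.

Lemma dotvv_lt_box t : dot t t < r ^+ 2 -> forall i, `|tnth t i| < r.
Proof.
move=> tr i; rewrite -(@ltr_pXn2r _ 2)// ?nnegrE ?(ltW r0)//.
rewrite real_normK ?num_real// (le_lt_trans _ tr)// /dot (bigD1 i)//= -expr2 lerDl.
by apply: sumr_ge0 => j _; rewrite -expr2 sqr_ge0.
Qed.

Lemma dotvv_le t (c : R) : (forall i, `|tnth t i| <= c) -> dot t t <= n%:R * c ^+ 2.
Proof.
move=> tc; rewrite -[n in n%:R]card_ord mulr_natl -sumr_const; apply: ler_sum => i _.
rewrite -expr2 -real_normK ?num_real// ler_pXn2r ?nnegrE//.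
exact: le_trans (tc i).
Qed.

(** Isometries preserve balls, not boxes. The box of half-side [c] lies in the ball of radius [r]
    because [n / (n + 1)^2 < 1], and that ball lies in the box of half-side [r]. *)
Let c := r / n.+1%:R.

Let c0 : 0 < c. Proof. by rewrite divr_gt0. Qed.

Let small_dotvv t : (forall i, `|tnth t i| <= c) -> dot t t < r ^+ 2.
Proof.
move=> /dotvv_le /le_lt_trans; apply.
rewrite /c expr_div_n mulrCA -[ltRHS]mulr1 ltr_pM2l ?exprn_gt0//.
rewrite ltr_pdivrMr ?exprn_gt0// mul1r -natrX ltr_nat.
by rewrite (leq_trans (ltnSn n))// -[X in (X <= _)%N]expn1 leq_pexp2l.
Qed.

(** Moving [rho] across the dot product replaces the sign vectors by their images under [rho'],
    which stay in the ball where the transform is finite. *)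
Let exp_integrable_isometry (rho rho' : n.-tuple R -> n.-tuple R) :
  measurable_fun setT rho ->
  (forall t y, dot t (rho y) = dot (rho' t) y) ->
  (forall t, dot (rho' t) (rho' t) = dot t t) ->
  exp_integrable mua (fun=> 1) rho c.
Proof.
move=> mrho adj iso; split => //.
  pose S y := \sum_(f : {ffun 'I_n -> bool})
    expR (dot (rho' [tuple (if f i then c else - c) | i < n]) y).
  apply: (@le_integrable _ _ _ mua setT measurableT _ (EFin \o S)).
  - apply/measurable_EFinP; apply: measurable_funM => //.
    apply: measurableT_comp => //; apply: measurable_funM => //.
    exact: (measurableT_comp measurable_l1norm mrho).
  - move=> y _; rewrite /= lee_fin mul1r ger0_norm ?expR_ge0//.
    rewrite (le_trans _ (ler_norm _))// (le_trans (expR_l1norm_le _ (ltW c0)))//.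
    by rewrite le_eqVlt; apply/orP; left; apply/eqP; apply: eq_bigr => f _; rewrite adj.
  - rewrite (_ : EFin \o S = (fun y => \sum_(f : {ffun 'I_n -> bool})
      (expR (dot (rho' [tuple (if f i then c else - c) | i < n]) y))%:E)%E).
      apply: integrable_sum => // f _.
      apply: (integrable_expR_dot laplaceE); apply: dotvv_lt_box.
      rewrite iso; apply: small_dotvv => i; rewrite tnth_mktuple.
      by case: (f i); rewrite ?normrN ger0_norm// ltW.
    by apply/funext => y; rewrite /= /S sumEFin.
Qed.

(** Here [rho'] plays the adjoint of [rho]: the transform of the image law at [t] is [L (rho' t)],
    and [L] sees only the squared norm. *)
Theorem isometry_invariant (rho rho' : n.-tuple R -> n.-tuple R) :
  measurable_fun setT rho ->
  (forall t y, dot t (rho y) = dot (rho' t) y) ->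
  (forall t, dot (rho' t) (rho' t) = dot t t) ->
  forall E, measurable E -> mua (rho @^-1` E) = mua E.
Proof.
move=> mrho adj iso E mE.
have mV : measurable (rho @^-1` E) by rewrite -[X in measurable X]setTI; exact: mrho.
have EI : exp_integrable mua (fun=> 1) id c by exact: (@exp_integrable_isometry id id).
have ER := exp_integrable_isometry mrho adj iso.
have : \int[mua]_(x in rho @^-1` E) 1 = \int[mua]_(x in id @^-1` E) 1.
  apply: (laplace_unique ER EI _ mE) => t tc.
  have bt : dot t t < r ^+ 2 by apply: small_dotvv => i; exact: ltW.
  transitivity (laplace mua (rho' t)).
    by apply: eq_Rintegral => y _; rewrite mul1r adj.
  rewrite (laplace_besselE laplaceE); last by apply: dotvv_lt_box; rewrite iso.
  rewrite iso -(laplace_besselE laplaceE); last exact: dotvv_lt_box.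
  by apply: eq_Rintegral => y _; rewrite mul1r.
rewrite !Rintegral_cst// !mul1r => fE.
rewrite -[LHS]fineK ?fin_num_measure// fE fineK ?fin_num_measure//.
Qed.

Let H := exp_integrable_half r0 laplaceE.

Let t0 : n.-tuple R := [tuple 0 | i < n].

Let t0_small i : `|tnth t0 i| < r / 2.
Proof. by rewrite tnth_mktuple normr0 divr_gt0. Qed.

Let dot0 y : dot t0 y = 0.
Proof. by apply: big1 => i _; rewrite tnth_mktuple mul0r. Qed.

Lemma integrable_moment g : subexponential g -> mua.-integrable setT (EFin \o g).
Proof.
move=> sg; apply: eq_integrable (integrable_subexponential0 H sg) => // x _.
by rewrite /= mul1r.
Qed.

(** The mean is the gradient of [L] at 0, which vanishes because [L] is radial. *)
Lemma mean0 i : \int[mua]_y (tnth y i) = 0.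
Proof.
transitivity (laplace1 mua i t0).
  by apply: eq_Rintegral => y _; rewrite dot0 expR0 mulr1.
by rewrite (laplace1E nu0 r0 series_gt0 laplaceE)// tnth_mktuple !mulr0.
Qed.

(** This is [laplace_identity] at [t = 0], where [L = 1] and the gradient is zero. *)
Lemma second_moment : \int[mua]_y (dot y y) = alpha.
Proof.
have L1 : laplace mua t0 = 1.
  rewrite /laplace; under eq_Rintegral do rewrite dot0 expR0.
  rewrite Rintegral_cst// mul1r.
  exact: (congr1 fine (probability_setT mua)).
have := laplace_identity nuE nu0 alpha0 r0 series_gt0 laplaceE t0_small.
rewrite L1 mul1r expr1n mulr1 [X in _ + _ * X]big1 ?mulr0 ?addr0 => [<-|i _].
  rewrite /dot Rintegral_sum; last first.
    move=> i; apply: integrable_moment.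
    by apply: subexponentialM; exact: subexponential_tnth.
  apply: eq_bigr => i _; apply: eq_Rintegral => y _.
  by rewrite dot0 expR0 mulr1 expr2.
by rewrite (laplace1E nu0 r0 series_gt0 laplaceE)// tnth_mktuple !mulr0 expr0n.
Qed.

End isometry_invariance.

(** * From the defining property of mu_alpha to a box around 0 *)

Section mu_alpha.
Context {R : realType} (beta : nat) (alpha : R).
Variable mua : probability (beta.+1.-tuple R) R.
Hypotheses (beta0 : (0 < beta)%N) (mualpha : is_mu_alpha alpha mua).

(** The Euclidean ball of the definition is traded for a box, shrunk further so that the Bessel
    series, equal to 1 at 0, stays positive by continuity. *)
Lemma is_mu_alpha_box : let nu := (beta%:R - 1) / 2 in exists r : R,
  [/\ 0 < r, forall t : beta.+1.-tuple R, (forall i, `|tnth t i| < r) ->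
    0 < bessel_series nu (dot t t) &
   forall t : beta.+1.-tuple R, (forall i, `|tnth t i| < r) ->
    (\int[mua]_y (expR (dot t y))%:E =
     (bessel_series nu (dot t t) `^ (- alpha))%:E)%E].
Proof.
move=> nu; have nu0 : 0 <= nu.
  by rewrite divr_ge0// subr_ge0 ler1n.
have [eps eps0 hL] := mualpha.
have cF : {for 0, continuous (bessel_series nu)}.
  apply: differentiable_continuous; apply/derivable1_diffP.
  exact: (@ex_derive _ _ _ _ _ _ _ (is_derive_bessel_series nu0 0)).
have : \forall x \near (0 : R), 0 < bessel_series nu x.
  by apply: (cvgr_gt _ cF); rewrite bessel_series0.
move=> [d /= d0 Fd].
pose m : R := Num.min (eps ^+ 2) d.
have m0 : 0 < m by rewrite lt_min d0 exprn_gt0.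
(* As [r <= 1], one has [(beta + 1) r^2 <= (beta + 1) r < (beta + 2) r <= m]; the extra unit gives
   strictness. *)
pose r : R := Num.min 1 (m / beta.+2%:R).
have r0 : 0 < r by rewrite lt_min ltr01 divr_gt0.
have rm (t : beta.+1.-tuple R) : (forall i, `|tnth t i| < r) -> dot t t < m :> R.
  move=> tr; apply: (@le_lt_trans _ _ (beta.+1%:R * r ^+ 2)).
    by apply: dotvv_le => i; exact: ltW.
  have r1 : r <= 1 by rewrite ge_min lexx.
  have r2 : r * beta.+2%:R <= m by rewrite -ler_pdivlMr// ge_min lexx orbT.
  apply: (@lt_le_trans _ _ (r * beta.+2%:R)) => //.
  rewrite -[beta.+2%:R]natr1 mulrDr mulr1 [ltLHS]mulrC.
  rewrite (@le_lt_trans _ _ (r * beta.+1%:R)) ?ltrDl//.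
  by rewrite expr2 ler_wpM2r// ler_piMl// ltW.
exists r; split=> // t /rm tm.
  apply: Fd; rewrite /= sub0r normrN ger0_norm ?dotvv_ge0//.
  by rewrite (lt_le_trans tm)// ge_min lexx orbT.
rewrite hL ?normalized_besselJE ?sqr_norm2//; first exact: sqrtr_ge0.
rewrite -(@ltr_pXn2r _ 2)// ?nnegrE ?sqrtr_ge0 ?(ltW eps0)// sqr_norm2.
by rewrite (lt_le_trans tm)// ge_min lexx.
Qed.

End mu_alpha.

(** * Quaternionic matrices *)

Section measurable_preimage.
Context {d1} {T1 : semiRingOfSetsType d1} {d2} {T2 : measurableType d2}.

(** The sets with measurable preimage under [g] form a sigma-algebra, so generators suffice. The
    general form serves quaternions by coordinates and matrices by entries. *)
Lemma g_sigma_preimage_measurable (aT : Type) n (f : 'I_n -> aT -> T1) (g : T2 -> aT)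
    (A : set aT) : (forall i, forall B, measurable B -> measurable ((f i \o g) @^-1` B)) ->
  g_sigma_preimage f A -> measurable (g @^-1` A).
Proof.
move=> mfg; pose G := [set A : set aT | measurable (g @^-1` A)].
suff: g_sigma_preimage f `<=` G by apply.
apply: smallest_sub.
  split; rewrite /G /=.
  - by rewrite preimage_set0.
  - by move=> B mB; rewrite setTD preimage_setC; exact: measurableC.
  - by move=> F mF; rewrite preimage_bigcup; exact: bigcupT_measurable.
rewrite -bigcup_seq; apply: bigcup_sub => i _ _ [B mB <-].
by rewrite setTI; exact: mfg.
Qed.

End measurable_preimage.

(** * Algebra and measurability of quaternions *)

Section quaternions.
Context {R : realType}.
Implicit Types p q : quat R.

Lemma quat_ext p q : re p = re q -> im_i p = im_i q -> im_j p = im_j q ->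
  im_k p = im_k q -> p = q.
Proof. by case: p; case: q => /= > -> -> -> ->. Qed.

Lemma qrealD (a b : R) : qreal (a + b) = qreal a + qreal b.
Proof. by apply: quat_ext; rewrite /= ?addr0. Qed.

Lemma qrealM (a b : R) : qreal (a * b) = qreal a * qreal b.
Proof. by apply: quat_ext => /=; ring. Qed.

Lemma qrealC (a : R) q : qreal a * q = q * qreal a.
Proof. by apply: quat_ext => /=; ring. Qed.

Lemma qconjD p q : qconj (p + q) = qconj p + qconj q.
Proof. by apply: quat_ext => /=; ring. Qed.

Lemma qconjM p q : qconj (p * q) = qconj q * qconj p.
Proof. by apply: quat_ext => /=; ring. Qed.

Lemma qconjK : involutive (@qconj R).
Proof. by case=> > /=; rewrite /qconj /= !opprK. Qed.

(** Stands in for commutativity: it makes the real part of the trace invariant under conjugation. *)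
Lemma reM_comm p q : re (p * q) = re (q * p).
Proof. by rewrite /=; ring. Qed.

Lemma measurable_qcoord k : measurable_fun setT (@qcoord R k).
Proof.
move=> _ B mB; rewrite setTI; apply: sub_sigma_algebra.
by rewrite -bigcup_seq; exists k; [exact: mem_index_enum|exists B => //; rewrite setTI].
Qed.

Section measurable_components.
Context {d} {T : measurableType d}.

Lemma measurable_quat (f : T -> quat R) :
  (forall k, measurable_fun setT (qcoord k \o f)) -> measurable_fun setT f.
Proof.
move=> mf _ A; rewrite setTI; apply: g_sigma_preimage_measurable => k B mB.
by rewrite -[X in measurable X]setTI; exact: mf.
Qed.

Variables f g : T -> quat R.
Hypotheses (mf : measurable_fun setT f) (mg : measurable_fun setT g).

Lemma measurable_qcoord_comp k : measurable_fun setT (fun x => qcoord k (f x)).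
Proof. exact: (measurableT_comp (measurable_qcoord k) mf). Qed.

Lemma measurable_re : measurable_fun setT (fun x => re (f x)).
Proof. exact: (measurable_qcoord_comp (@Ordinal 4 0 isT)). Qed.

Lemma measurable_im_i : measurable_fun setT (fun x => im_i (f x)).
Proof. exact: (measurable_qcoord_comp (@Ordinal 4 1 isT)). Qed.

Lemma measurable_im_j : measurable_fun setT (fun x => im_j (f x)).
Proof. exact: (measurable_qcoord_comp (@Ordinal 4 2 isT)). Qed.

Lemma measurable_im_k : measurable_fun setT (fun x => im_k (f x)).
Proof. exact: (measurable_qcoord_comp (@Ordinal 4 3 isT)). Qed.

End measurable_components.

Lemma measurable_Quat d (T : measurableType d) (a b c e : T -> R) :
  measurable_fun setT a -> measurable_fun setT b -> measurable_fun setT c ->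
  measurable_fun setT e -> measurable_fun setT (fun x => Quat (a x) (b x) (c x) (e x)).
Proof.
by move=> ma mb mc me; apply: measurable_quat => -[[|[|[|[|k]]]] hk].
Qed.

Lemma measurable_quatD d (T : measurableType d) (f g : T -> quat R) :
  measurable_fun setT f -> measurable_fun setT g ->
  measurable_fun setT (fun x => f x + g x).
Proof.
move=> mf mg; apply: (measurable_Quat (a := fun x => re (f x) + re (g x))
  (b := fun x => im_i (f x) + im_i (g x)) (c := fun x => im_j (f x) + im_j (g x))
  (e := fun x => im_k (f x) + im_k (g x))); apply: measurable_funD;
  by [exact: measurable_re|exact: measurable_im_i|exact: measurable_im_j|exact: measurable_im_k].
Qed.

Lemma measurable_quatM d (T : measurableType d) (f g : T -> quat R) :
  measurable_fun setT f -> measurable_fun setT g ->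
  measurable_fun setT (fun x => f x * g x).
Proof.
move=> mf mg.
have f0 := measurable_re mf; have f1 := measurable_im_i mf.
have f2 := measurable_im_j mf; have f3 := measurable_im_k mf.
have g0 := measurable_re mg; have g1 := measurable_im_i mg.
have g2 := measurable_im_j mg; have g3 := measurable_im_k mg.
by apply: measurable_quat => -[[|[|[|[|k]]]] hk] //; rewrite /comp /qcoord /=;
  repeat first [apply: measurable_funB | apply: measurable_funD | apply: measurable_funM].
Qed.

Lemma measurable_qconj d (T : measurableType d) (f : T -> quat R) :
  measurable_fun setT f -> measurable_fun setT (fun x => qconj (f x)).
Proof.
move=> mf; apply: measurable_Quat; first exact: measurable_re.
- by apply: measurableT_comp => //; exact: measurable_im_i.
- by apply: measurableT_comp => //; exact: measurable_im_j.
- by apply: measurableT_comp => //; exact: measurable_im_k.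
Qed.

End quaternions.

(** * Algebra and measurability of 2 x 2 quaternionic matrices *)

Section quaternionic_matrices.
Context {R : realType}.
Implicit Types M N : 'M[quat R]_2.

Lemma measurable_entry i j : measurable_fun setT (fun M => M i j).
Proof.
move=> _ B mB; rewrite setTI; apply: sub_sigma_algebra.
rewrite -bigcup_seq; exists (mxvec_index i j); first exact: mem_index_enum.
by exists B => //; rewrite setTI; apply/seteqP; split=> M /=; rewrite mxvecE.
Qed.

Lemma measurable_mx d (T : measurableType d) (f : T -> 'M[quat R]_2) :
  (forall i j, measurable_fun setT (fun x => f x i j)) -> measurable_fun setT f.
Proof.
move=> mf _ A; rewrite setTI; apply: g_sigma_preimage_measurable => k B mB.
case/mxvec_indexP: k => i j.
rewrite (_ : _ @^-1` B = (fun x => f x i j) @^-1` B); last first.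
  by apply/seteqP; split=> x /=; rewrite mxvecE.
by rewrite -[X in measurable X]setTI; exact: mf.
Qed.

Lemma measurable_mx_entry d (T : measurableType d) (f : T -> 'M[quat R]_2) i j :
  measurable_fun setT f -> measurable_fun setT (fun x => f x i j).
Proof. by move=> mf; exact: (measurableT_comp (measurable_entry i j) mf). Qed.

Lemma measurable_mxcoord d (T : measurableType d) (f : T -> 'M[quat R]_2) i j k :
  measurable_fun setT f -> measurable_fun setT (fun x => mxcoord i j k (f x)).
Proof. by move=> mf; apply: measurable_qcoord_comp; exact: measurable_mx_entry. Qed.

Lemma measurable_mxD d (T : measurableType d) (f g : T -> 'M[quat R]_2) :
  measurable_fun setT f -> measurable_fun setT g ->
  measurable_fun setT (fun x => f x + g x).
Proof.
move=> mf mg; apply: measurable_mx => i j; under eq_fun do rewrite mxE.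
by apply: measurable_quatD; exact: measurable_mx_entry.
Qed.

Lemma mulmx2E M N i j : (M *m N) i j = M i 0 * N 0 j + M i 1 * N 1 j.
Proof.
rewrite mxE big_ord_recl big_ord1.
by congr (_ + M i _ * N _ j); exact/val_inj.
Qed.

Lemma measurable_mxM d (T : measurableType d) (f g : T -> 'M[quat R]_2) :
  measurable_fun setT f -> measurable_fun setT g ->
  measurable_fun setT (fun x => f x *m g x).
Proof.
move=> mf mg; apply: measurable_mx => i j; under eq_fun do rewrite mulmx2E.
by apply: measurable_quatD; apply: measurable_quatM; exact: measurable_mx_entry.
Qed.

Lemma measurable_mxZ d (T : measurableType d) q (f : T -> 'M[quat R]_2) :
  measurable_fun setT f -> measurable_fun setT (fun x => q *: f x).
Proof.
move=> mf; apply: measurable_mx => i j; under eq_fun do rewrite mxE.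
by apply: measurable_quatM => //; exact: measurable_mx_entry.
Qed.

Lemma ord2P (i : 'I_2) : i = 0 \/ i = 1.
Proof. by case: i => [[|[|i]] hi] //; [left|right]; exact/val_inj. Qed.

Lemma mx2P M N : M 0 0 = N 0 0 -> M 0 1 = N 0 1 -> M 1 0 = N 1 0 -> M 1 1 = N 1 1 ->
  M = N.
Proof.
move=> e00 e01 e10 e11; apply/matrixP => i j.
by case: (ord2P i) => ->; case: (ord2P j) => ->.
Qed.

Lemma adjointE M i j : adjoint M i j = qconj (M j i).
Proof. by rewrite !mxE. Qed.

Lemma adjointM M N : adjoint (M *m N) = adjoint N *m adjoint M.
Proof.
apply/matrixP => i j.
by rewrite adjointE !mulmx2E qconjD !qconjM !adjointE.
Qed.

Lemma adjointK : involutive (@adjoint R).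
Proof. by move=> M; apply/matrixP => i j; rewrite !adjointE qconjK. Qed.

Lemma qreal_scalarC (a : R) M : M *m (qreal a)%:M = qreal a *: M.
Proof.
by apply: mx2P; rewrite mulmx2E !mxE /= ?mulr1n ?mulr0n ?mulr0 ?addr0 ?add0r qrealC.
Qed.

Lemma qreal_scalemxAr (a : R) M N : M *m (qreal a *: N) = qreal a *: (M *m N).
Proof.
apply/matrixP => i j; rewrite !mxE mulr_sumr; apply: eq_bigr => k _.
by rewrite mxE !mulrA qrealC.
Qed.

End quaternionic_matrices.

(** * Traceless Hermitian matrices as Euclidean vectors, and their rotations *)

Section hyperbolic_matrices.
Context {R : realType} (beta : nat).
Hypothesis hbeta : beta \in [:: 1; 2; 4]%N.
Implicit Types (x y t : beta.+1.-tuple R) (M U : 'M[quat R]_2).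

Let beta_cases : [\/ beta = 1, beta = 2 | beta = 4]%N.
Proof.
move: hbeta; rewrite !inE => /or3P[] /eqP ->; by [apply: Or31|apply: Or32|apply: Or33].
Qed.

Let beta4 : (beta <= 4)%N. Proof. by case: beta_cases => ->. Qed.

(** Padding with zeros to five coordinates lets a single ring computation treat all three values of
    [beta]. *)
Lemma dot_nthE x y : dot x y = x`_0 * y`_0 + x`_1 * y`_1 + x`_2 * y`_2 +
  x`_3 * y`_3 + x`_4 * y`_4.
Proof.
have nz k : (beta < k)%N -> x`_k * y`_k = 0.
  by move=> bk; rewrite nth_default ?mul0r// size_tuple.
transitivity (\sum_(0 <= i < 5) x`_i * y`_i); last first.
  by rewrite !big_nat_recr ?big_geq//= add0r.
rewrite (@big_cat_nat _ _ _ beta.+1)//= [X in _ + X]big_nat_cond.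
rewrite [X in _ + X]big1 ?addr0; last by move=> i /andP[/andP[+ _] _]; exact: nz.
rewrite big_mkord; apply: eq_bigr => i _.
by rewrite !(tnth_nth 0).
Qed.

Definition tuple_comb (c : R) x y : beta.+1.-tuple R :=
  [tuple tnth x i + c * tnth y i | i < beta.+1].

Lemma nth_tuple_comb c x y k : (tuple_comb c x y)`_k = x`_k + c * y`_k.
Proof.
have [bk|kb] := ltnP k beta.+1; last first.
  by rewrite !nth_default ?size_tuple ?mulr0 ?addr0.
by rewrite -[k]/(val (Ordinal bk)) -!tnth_nth tnth_mktuple.
Qed.

Lemma sqdistE c x y : sqdist c (x, y) = dot (tuple_comb c x y) (tuple_comb c x y).
Proof. by apply: eq_bigr => i _; rewrite tnth_mktuple expr2. Qed.

Lemma tuple_addE x y : tuple_add x y = tuple_comb 1 x y.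
Proof. by apply: eq_from_tnth => i; rewrite !tnth_mktuple mul1r. Qed.

Lemma hyperbolic_mx_comb c x y :
  hyperbolic_mx (tuple_comb c x y) = hyperbolic_mx x + qreal c *: hyperbolic_mx y.
Proof.
by apply: mx2P; rewrite !mxE /= !nth_tuple_comb; apply: quat_ext => /=; ring.
Qed.

(** The off-diagonal entries of the square cancel because the two diagonal entries are opposite
    reals, which commute with [q]; each diagonal entry becomes [xi_1^2 + |q|^2]. *)
Lemma sqmx_hyperbolic x : sqmx (hyperbolic_mx x) = (qreal (dot x x))%:M.
Proof.
rewrite dot_nthE /sqmx.
by apply: mx2P; rewrite mulmx2E !mxE /= ?mulr1n ?mulr0n; apply: quat_ext => /=; ring.
Qed.

Lemma scalars_nth k (q : quat R) : scalars beta q -> (beta <= k)%N ->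
  [:: re q; im_i q; im_j q; im_k q]`_k = 0.
Proof.
move=> sq bk; have [k4|k4] := ltnP k 4; last by rewrite nth_default.
exact: (sq (Ordinal k4)).
Qed.

Lemma scalarsP (q : quat R) : scalars beta q <->
  [/\ (beta <= 1)%N -> im_i q = 0, (beta <= 2)%N -> im_j q = 0 &
    (beta <= 3)%N -> im_k q = 0].
Proof.
split=> [sq|[s1 s2 s3] [[|[|[|[|k]]]] hk] //=].
  by split; [exact: (@scalars_nth 1)|exact: (@scalars_nth 2)|exact: (@scalars_nth 3)].
by case: beta_cases => ->.
Qed.

Lemma scalarsD (p q : quat R) : scalars beta p -> scalars beta q -> scalars beta (p + q).
Proof.
move=> /scalarsP[p1 p2 p3] /scalarsP[q1 q2 q3]; apply/scalarsP.
by split=> bk; rewrite /= ?p1 ?p2 ?p3 ?q1 ?q2 ?q3 ?addr0.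
Qed.

Lemma scalarsM (p q : quat R) : scalars beta p -> scalars beta q -> scalars beta (p * q).
Proof.
move=> /scalarsP[p1 p2 p3] /scalarsP[q1 q2 q3]; apply/scalarsP.
split=> bk /=.
- have b2 := leq_trans bk (isT : (1 <= 2)%N); have b3 := leq_trans bk (isT : (1 <= 3)%N).
  by rewrite p1// p2// p3// q1// q2// q3//; ring.
- have b3 := leq_trans bk (isT : (2 <= 3)%N).
  by rewrite p2// p3// q2// q3//; ring.
(* The value 3 must be excluded: the span of 1, i, j is not closed under products, as ij = k. *)
- have b2 : (beta <= 2)%N by case: beta_cases bk => ->.
  by rewrite p2// p3// q2// q3//; ring.
Qed.

Lemma scalars_conj (q : quat R) : scalars beta q -> scalars beta (qconj q).
Proof.
move=> /scalarsP[q1 q2 q3]; apply/scalarsP.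
by split=> bk /=; rewrite ?q1 ?q2 ?q3 ?oppr0.
Qed.

Lemma hermitian_hyperbolic x : Defs.hermitian beta (hyperbolic_mx x).
Proof.
have s0 a : scalars beta (qreal a : quat R) by apply/scalarsP.
have sx : scalars beta (Quat x`_1 x`_2 x`_3 x`_4).
  by apply/scalarsP; split=> bk /=; rewrite nth_default ?size_tuple.
split=> [i j|].
  by rewrite mxE; case: ifP => _; case: ifP => _ //; exact: scalars_conj.
by apply: mx2P; rewrite adjointE !mxE /=; apply: quat_ext; rewrite /= ?oppr0 ?opprK.
Qed.

Definition hyperbolic_coords M : beta.+1.-tuple R :=
  [tuple [:: re (M 0 0); re (M 0 1); im_i (M 0 1); im_j (M 0 1); im_k (M 0 1)]`_i
    | i < beta.+1].

Lemma hyperbolic_coordsK x : hyperbolic_coords (hyperbolic_mx x) = x.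
Proof.
apply: eq_from_tnth => i; rewrite tnth_mktuple !mxE /= (tnth_nth 0).
have : (i < 5)%N by rewrite (leq_trans (ltn_ord i)).
by case: (nat_of_ord i) => [|[|[|[|[|k]]]]].
Qed.

Let opp_self (a : R) : - a = a -> a = 0.
Proof. by move=> aa; lra. Qed.

(** With [hyperbolic_coordsK], this identifies R^(beta + 1) with the traceless Hermitian matrices, a
    space stable under conjugation by unitaries. *)
Lemma hyperbolic_mxK M : Defs.hermitian beta M -> re (M 0 0) + re (M 1 1) = 0 ->
  hyperbolic_mx (hyperbolic_coords M) = M.
Proof.
move=> [sM hM] trM.
have nthE k : (hyperbolic_coords M)`_k =
    [:: re (M 0 0); re (M 0 1); im_i (M 0 1); im_j (M 0 1); im_k (M 0 1)]`_k.
  have [bk|kb] := ltnP k beta.+1.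
    by have /= <- := tnth_nth 0 (hyperbolic_coords M) (Ordinal bk); rewrite tnth_mktuple.
  rewrite nth_default ?size_tuple//.
  by case: k kb => [|k]//; rewrite ltnS => kb; rewrite /= (scalars_nth (sM 0 1)).
have h i j : qconj (M j i) = M i j by rewrite -{2}hM adjointE.
have d (i : 'I_2) : M i i = qreal (re (M i i)).
  have /(congr1 (fun q => (im_i q, im_j q, im_k q))) [e1 e2 e3] := h i i.
  by apply: quat_ext => //=; exact: opp_self.
apply: mx2P; rewrite mxE /= !nthE /=.
- by rewrite [RHS]d.
- by apply: quat_ext.
- by rewrite -(h 1 0).
- by rewrite [RHS]d; congr qreal; lra.
Qed.

Let retr M := re (M 0 0) + re (M 1 1).

Let retr_comm M N : retr (M *m N) = retr (N *m M).
Proof.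
have reD (p q : quat R) : re (p + q) = re p + re q by [].
rewrite /retr !mulmx2E !reD (reM_comm (N 0 0)) (reM_comm (N 0 1)).
by rewrite (reM_comm (N 1 0)) (reM_comm (N 1 1)) addrACA.
Qed.

Lemma hermitian_conjugate U M : unitary beta U -> Defs.hermitian beta M ->
  Defs.hermitian beta (U *m M *m adjoint U).
Proof.
move=> [sU _ _] [sM hM]; split; last by rewrite !adjointM adjointK hM mulmxA.
have sMM (A B : 'M[quat R]_2) : (forall i j, scalars beta (A i j)) ->
    (forall i j, scalars beta (B i j)) -> forall i j, scalars beta ((A *m B) i j).
  by move=> sA sB i j; rewrite mulmx2E; apply: scalarsD; exact: scalarsM.
apply: (sMM) => [|i j]; first exact: sMM.
by rewrite adjointE; exact: scalars_conj.
Qed.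

(** The orthogonal map of R^(beta + 1) induced by conjugation with a unitary [U]. *)
Definition conj_coords U x := hyperbolic_coords (U *m hyperbolic_mx x *m adjoint U).

Lemma hyperbolic_mx_conj U x : unitary beta U ->
  hyperbolic_mx (conj_coords U x) = U *m hyperbolic_mx x *m adjoint U.
Proof.
move=> uU; apply: hyperbolic_mxK.
  by apply: hermitian_conjugate => //; exact: hermitian_hyperbolic.
have [_ _ UU] := uU.
rewrite -/(retr _) retr_comm mulmxA UU mul1mx /retr !mxE /=; exact: subrr.
Qed.

Lemma conj_coords_comb U c x y : unitary beta U ->
  conj_coords U (tuple_comb c x y) = tuple_comb c (conj_coords U x) (conj_coords U y).
Proof.
move=> uU; apply: (can_inj hyperbolic_coordsK).
apply: (etrans (hyperbolic_mx_conj (tuple_comb c x y) uU)); apply: esym.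
apply: (etrans (hyperbolic_mx_comb c (conj_coords U x) (conj_coords U y))).
apply: (etrans (congr2 (fun M N => M + qreal c *: N)
  (hyperbolic_mx_conj x uU) (hyperbolic_mx_conj y uU))).
by rewrite hyperbolic_mx_comb mulmxDr mulmxDl qreal_scalemxAr -scalemxAl.
Qed.

(** The squared norm can be read off the matrix square, and conjugation fixes that square because it
    is a real multiple of the identity. *)
Lemma dotvv_conj_coords U x : unitary beta U ->
  dot (conj_coords U x) (conj_coords U x) = dot x x.
Proof.
move=> uU; have [_ UU U'U] := uU.
have : sqmx (hyperbolic_mx (conj_coords U x)) = (qreal (dot x x))%:M.
  rewrite hyperbolic_mx_conj// /sqmx -!mulmxA (mulmxA (adjoint U)) U'U mul1mx.
  rewrite (mulmxA (hyperbolic_mx x)) -/(sqmx _) sqmx_hyperbolic mulmxA.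
  by rewrite qreal_scalarC -scalemxAl UU scale_scalar_mx mulr1.
rewrite sqmx_hyperbolic => /matrixP/(_ 0 0).
by rewrite !mxE /= !mulr1n => -[].
Qed.

Lemma dot_comb1 x y : dot (tuple_comb 1 x y) (tuple_comb 1 x y) =
  dot x x + 2 * dot x y + dot y y.
Proof. by rewrite !dot_nthE !nth_tuple_comb; ring. Qed.

(** Polarization, using the linearity in [conj_coords_comb]. *)
Lemma dot_conj_coords U x y : unitary beta U ->
  dot (conj_coords U x) (conj_coords U y) = dot x y.
Proof.
move=> uU; have polar (a b c a' b' c' : R) : a + 2 * b + c = a' + 2 * b' + c' ->
    a = a' -> c = c' -> b = b' by lra.
have e := dotvv_conj_coords (tuple_comb 1 x y) uU; rewrite (conj_coords_comb 1 x y uU) in e.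
have e' := etrans (esym (dot_comb1 (conj_coords U x) (conj_coords U y)))
  (etrans e (dot_comb1 x y)).
exact: polar e' (dotvv_conj_coords x uU) (dotvv_conj_coords y uU).
Qed.

Lemma unitary_adjoint U : unitary beta U -> unitary beta (adjoint U).
Proof.
move=> [sU UU U'U]; split; rewrite ?adjointK// => i j.
by rewrite adjointE; exact: scalars_conj.
Qed.

(** Conjugations by [U] and by its adjoint are mutually inverse isometries, hence transposes of each
    other: the pair that [isometry_invariant] asks for. *)
Lemma conj_coords_adjoint U x y : unitary beta U ->
  dot x (conj_coords U y) = dot (conj_coords (adjoint U) x) y.
Proof.
move=> uU; rewrite -[RHS](dot_conj_coords _ _ uU); congr (dot _ _).
have [_ UU _] := uU; apply: (can_inj hyperbolic_coordsK).
rewrite !hyperbolic_mx_conj ?adjointK//; last exact: unitary_adjoint.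
by rewrite !mulmxA UU mul1mx -mulmxA UU mulmx1.
Qed.

Lemma measurable_nth k : measurable_fun setT (fun x => x`_k).
Proof.
have [bk|kb] := ltnP k beta.+1.
  rewrite (_ : (fun x => _) = fun x => tnth x (Ordinal bk)).
    exact: measurable_tnth.
  by apply/funext => x; rewrite (tnth_nth 0).
rewrite (_ : (fun x => _) = cst 0)//.
by apply/funext => x; rewrite nth_default// size_tuple.
Qed.

Lemma measurable_hyperbolic_mx : measurable_fun setT (@hyperbolic_mx R beta).
Proof.
have mq : measurable_fun setT (fun x => Quat x`_1 x`_2 x`_3 x`_4).
  by apply: measurable_Quat; exact: measurable_nth.
apply: measurable_mx => i j; under eq_fun do rewrite mxE.
case: (i == 0); case: (j == 0).
- by apply: measurable_Quat => //; exact: measurable_nth.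
- exact: mq.
- exact: measurable_qconj.
- apply: measurable_Quat => //; apply: measurableT_comp => //.
  exact: measurable_nth.
Qed.

Lemma measurable_hyperbolic_coords : measurable_fun setT hyperbolic_coords.
Proof.
apply/measurable_fun_tnthP => i.
rewrite (_ : _ \o _ = fun M =>
   [:: re (M 0 0); re (M 0 1); im_i (M 0 1); im_j (M 0 1); im_k (M 0 1)]`_i); last first.
  by apply/funext => M; rewrite /= tnth_mktuple.
case: (nat_of_ord i) => [|[|[|[|[|k]]]]] /=.
- by apply: measurable_re; exact: measurable_entry.
- by apply: measurable_re; exact: measurable_entry.
- by apply: measurable_im_i; exact: measurable_entry.
- by apply: measurable_im_j; exact: measurable_entry.
- by apply: measurable_im_k; exact: measurable_entry.
- by rewrite (_ : (fun M => _) = cst 0)//; apply/funext => M; rewrite nth_nil.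
Qed.

Lemma measurable_conj_coords U : measurable_fun setT (conj_coords U).
Proof.
apply: (measurableT_comp measurable_hyperbolic_coords).
apply: measurable_mxM => //; apply: measurable_mxM => //.
exact: measurable_hyperbolic_mx.
Qed.

(** Being Hermitian with entries in the right scalars is a finite system of equations between real
    coordinates. *)
Lemma measurable_hermitian : measurable (@Defs.hermitian R beta).
Proof.
pose V i j k := [set M : 'M[quat R]_2 |
  mxcoord i j k (adjoint M) - mxcoord i j k M = 0 /\
  ((beta <= k)%N -> mxcoord i j k M = 0)].
have mad : measurable_fun setT (@adjoint R).
  apply: measurable_mx => i j; under eq_fun do rewrite adjointE.
  by apply: measurable_qconj; exact: measurable_entry.
have mid : measurable_fun setT (@id 'M[quat R]_2) by exact: measurable_id.
have mV i j k : measurable (V i j k).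
  have mzero (f : 'M[quat R]_2 -> R) : measurable_fun setT f -> measurable [set M | f M = 0].
    by move=> mf; rewrite -[X in measurable X]setTI; exact: (mf measurableT [set 0] (measurable_set1 0)).
  apply: measurableI.
    apply: mzero; apply: measurable_funB; exact: measurable_mxcoord.
  case: (beta <= k)%N.
    rewrite [X in measurable X](_ : _ = [set M | mxcoord i j k M = 0]).
      by apply: mzero; exact: measurable_mxcoord.
    by apply/seteqP; split=> M /=; [apply|].
  by rewrite [X in measurable X](_ : _ = setT)//; apply/seteqP; split.
rewrite (_ : Defs.hermitian _ = \bigcap_i \bigcap_j \bigcap_k V i j k).
  apply: fin_bigcap_measurable => // i _; apply: fin_bigcap_measurable => // j _.
  by apply: fin_bigcap_measurable => // k _.
apply/seteqP; split=> [M [sM hM] i _ j _ k _|M hM].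
  by split; [rewrite hM subrr|exact: sM].
split=> [i j k bk|]; first by have [_ /(_ bk)] := hM i I j I k I.
apply/matrixP => i j.
have e (k : 'I_4) : mxcoord i j k (adjoint M) = mxcoord i j k M.
  by have [/eqP + _] := hM i I j I k I; rewrite subr_eq0 => /eqP.
apply: quat_ext.
- exact: (e (@Ordinal 4 0 isT)).
- exact: (e (@Ordinal 4 1 isT)).
- exact: (e (@Ordinal 4 2 isT)).
- exact: (e (@Ordinal 4 3 isT)).
Qed.

End hyperbolic_matrices.

(** * The exceptional hyperbolic ensemble *)

Section same_image_measure.
Context {R : realType} {d1 d2 d : measure_display}.
Context {T1 : measurableType d1} {T2 : measurableType d2} {Y : measurableType d}.
Variables (m1 : {measure set T1 -> \bar R}) (m2 : {measure set T2 -> \bar R}).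
Variables (phi1 : T1 -> Y) (phi2 : T2 -> Y).
Hypotheses (mphi1 : measurable_fun setT phi1) (mphi2 : measurable_fun setT phi2).
Hypothesis same_image : forall A, measurable A -> m1 (phi1 @^-1` A) = m2 (phi2 @^-1` A).

Variable f : Y -> R.
Hypothesis mf : measurable_fun setT f.
Hypothesis i2 : m2.-integrable setT (fun x => (f (phi2 x))%:E).

Lemma integrable_same_image : m1.-integrable setT (fun x => (f (phi1 x))%:E).
Proof.
have mfe : measurable_fun setT (fun y => `|(f y)%:E|%E).
  by apply: measurableT_comp => //; exact/measurable_EFinP.
have /integrableP[_ lt2] := i2.
apply/integrableP; split; first exact/measurable_EFinP/(measurableT_comp mf mphi1).
have <- := @ge0_integral_pushforward _ _ _ _ R _ mphi1 m1 setT _ measurableT mfe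
  (fun y _ => abse_ge0 _).
rewrite (@eq_measure_integral _ _ _ setT (pushforward m2 phi2)).
  rewrite (@ge0_integral_pushforward _ _ _ _ R _ mphi2 m2 setT _ measurableT mfe)//.
by move=> A mA _; exact: same_image.
Qed.

Lemma integral_same_image D : measurable D ->
  (\int[m1]_(x in phi1 @^-1` D) (f (phi1 x))%:E =
   \int[m2]_(x in phi2 @^-1` D) (f (phi2 x))%:E)%E.
Proof.
move=> mD; have mfe : measurable_fun setT (EFin \o f) by exact/measurable_EFinP.
have mV1 : measurable (phi1 @^-1` D) by rewrite -[X in measurable X]setTI; exact: mphi1.
have mV2 : measurable (phi2 @^-1` D) by rewrite -[X in measurable X]setTI; exact: mphi2.
have j1 : m1.-integrable (phi1 @^-1` D) ((EFin \o f) \o phi1).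
  exact: (integrableS measurableT mV1 _ integrable_same_image).
have j2 : m2.-integrable (phi2 @^-1` D) ((EFin \o f) \o phi2).
  exact: (integrableS measurableT mV2 _ i2).
rewrite -[LHS](integral_pushforward mphi1 mfe j1 mD).
rewrite -[RHS](integral_pushforward mphi2 mfe j2 mD).
by apply: eq_measure_integral => A mA _; exact: same_image.
Qed.

End same_image_measure.

(** * Transfer from mu_alpha to random matrices *)

Section hyperbolic_law.
Context {R : realType} (beta : nat) (alpha : R).
Variable mua : probability (beta.+1.-tuple R) R.
Hypotheses (hbeta : beta \in [:: 1; 2; 4]%N) (alpha0 : 0 < alpha).
Hypothesis mualpha : is_mu_alpha alpha mua.
Let M2 : measurableType _ := 'M[quat R]_2.
Notation hyp := (@hyperbolic_mx R beta).

Let nu : R := (beta%:R - 1) / 2.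

Let beta0 : (0 < beta)%N. Proof. by move: hbeta; rewrite !inE => /or3P[] /eqP ->. Qed.

Let nu0 : 0 <= nu.
Proof. by rewrite divr_ge0// subr_ge0 ler1n. Qed.

Let nuE : 2 * (nu + 1) = beta.+1%:R.
Proof. by rewrite /nu -natr1; field. Qed.

Lemma hyperbolic_subexponential_integrable g : subexponential g ->
  mua.-integrable setT (EFin \o g).
Proof.
have [r [r0 _ lE]] := is_mu_alpha_box beta0 mualpha.
exact: integrable_moment r0 lE _.
Qed.

Lemma mean_nth k : \int[mua]_x x`_k = 0.
Proof.
have [r [r0 sg lE]] := is_mu_alpha_box beta0 mualpha.
have [bk|kb] := ltnP k beta.+1.
  transitivity (\int[mua]_x (tnth x (Ordinal bk))).
    by apply: eq_Rintegral => x _; rewrite (tnth_nth 0).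
  exact: (mean0 nu0 r0 sg lE).
transitivity (\int[mua]_x (cst 0 x)).
  by apply: eq_Rintegral => x _; rewrite nth_default// size_tuple.
by rewrite /Rintegral /= integral0.
Qed.

Lemma subexponential_nth k : subexponential (fun x : beta.+1.-tuple R => x`_k).
Proof.
have [bk|kb] := ltnP k beta.+1.
  rewrite (_ : (fun x => _) = fun x => tnth x (Ordinal bk)).
    exact: subexponential_tnth.
  by apply/funext => x; rewrite (tnth_nth 0).
rewrite (_ : (fun x => _) = cst 0); first exact: subexponential_cst.
by apply/funext => x; rewrite nth_default ?size_tuple.
Qed.

(** Reduces growth bounds and means of matrix entries to those of single coordinates; the factor is
    0, 1 or -1. *)
Lemma mxcoord_hyperbolic i j k : exists (e : R) (l : nat),
  forall x, mxcoord i j k (hyp x) = e * x`_l.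
Proof.
rewrite /mxcoord /qcoord.
have [->|->] := ord2P i; have [->|->] := ord2P j; case: k => [[|[|[|[|k]]]] hk] //.
- by exists 1, 0%N => x; rewrite mxE /= mul1r.
- by exists 0, 0%N => x; rewrite mxE /= mul0r.
- by exists 0, 0%N => x; rewrite mxE /= mul0r.
- by exists 0, 0%N => x; rewrite mxE /= mul0r.
- by exists 1, 1%N => x; rewrite mxE /= mul1r.
- by exists 1, 2%N => x; rewrite mxE /= mul1r.
- by exists 1, 3%N => x; rewrite mxE /= mul1r.
- by exists 1, 4%N => x; rewrite mxE /= mul1r.
- by exists 1, 1%N => x; rewrite mxE /= mul1r.
- by exists (-1), 2%N => x; rewrite mxE /= mulN1r.
- by exists (-1), 3%N => x; rewrite mxE /= mulN1r.
- by exists (-1), 4%N => x; rewrite mxE /= mulN1r.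
- by exists (-1), 0%N => x; rewrite mxE /= mulN1r.
- by exists 0, 0%N => x; rewrite mxE /= mul0r.
- by exists 0, 0%N => x; rewrite mxE /= mul0r.
- by exists 0, 0%N => x; rewrite mxE /= mul0r.
Qed.

Lemma subexponential_mxcoord i j k : subexponential (fun x => mxcoord i j k (hyp x)).
Proof.
have [e [l E]] := mxcoord_hyperbolic i j k.
have -> : (fun x => mxcoord i j k (hyp x)) = cst e \* (fun x => x`_l) by exact/funext.
by apply: subexponentialM; [exact: subexponential_cst|exact: subexponential_nth].
Qed.

Lemma mean_mxcoord i j k : \int[mua]_x mxcoord i j k (hyp x) = 0.
Proof.
have [e [l E]] := mxcoord_hyperbolic i j k.
under eq_Rintegral do rewrite E.
have il := hyperbolic_subexponential_integrable (subexponential_nth l).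
by rewrite (RintegralZl _ _ il)// mean_nth mulr0.
Qed.

Lemma hyperbolic_rotation U : unitary beta U -> forall E, measurable E ->
  mua (conj_coords U @^-1` E) = mua E.
Proof.
move=> uU; have [r [r0 sg lE]] := is_mu_alpha_box beta0 mualpha.
apply: (isometry_invariant r0 lE (rho' := conj_coords (adjoint U))).
- exact: measurable_conj_coords.
- by move=> t y; exact: conj_coords_adjoint.
- by move=> t; apply: dotvv_conj_coords => //; exact: unitary_adjoint.
Qed.

Lemma hyperbolic_second_moment : \int[mua]_x dot x x = alpha.
Proof.
have [r [r0 sg lE]] := is_mu_alpha_box beta0 mualpha.
exact: (second_moment nuE nu0 alpha0 r0 sg lE).
Qed.

Definition scalar_coord (i j : 'I_2) (k : 'I_4) : R := ((i == j) && (k == 0))%:R.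

Lemma mxcoord_scalar i j k (a : R) :
  mxcoord i j k (qreal a)%:M = a * scalar_coord i j k.
Proof.
rewrite /mxcoord /qcoord /scalar_coord !mxE; case: (i == j).
  by rewrite mulr1n; case: k => [[|[|[|[|k]]]] hk] //=; rewrite ?mulr1 ?mulr0.
by rewrite mulr0n mulr0; case: k => [[|[|[|[|k]]]] hk].
Qed.

Let A := 1 / (1 + 2 * alpha).
Let C := 4 * alpha ^+ 2 / (2 * alpha + 1).

(* [c = 1] is the ensemble itself and [c = 1 / s] its standardized version. *)
Variable c : R.
Let hc (x : beta.+1.-tuple R) : 'M[quat R]_2 := qreal c *: hyp x.

Let mhc : measurable_fun setT hc.
Proof. by apply: measurable_mxZ; exact: measurable_hyperbolic_mx. Qed.

Let sqmx_scale x : sqmx (hc x) = (qreal (c ^+ 2 * dot x x))%:M.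
Proof.
rewrite /sqmx /hc qreal_scalemxAr -scalemxAl -/(sqmx _) sqmx_hyperbolic//.
by rewrite !scale_scalar_mx -!qrealM mulrA.
Qed.

Let hc_comb e x y : hc (tuple_comb e x y) = hc x + qreal e *: hc y.
Proof. by rewrite /hc hyperbolic_mx_comb scalerDr !scalerA qrealC. Qed.

Context {d} {T : measurableType d} (P : probability T R).
Variables X Y : T -> 'M[quat R]_2.
Hypotheses (mX : measurable_fun setT X) (mY : measurable_fun setT Y).
Hypothesis lawX : forall E, measurable E -> P (X @^-1` E) = mua (hc @^-1` E).
Hypothesis lawY : forall E, measurable E -> P (Y @^-1` E) = mua (hc @^-1` E).
Hypothesis XY : independent P X Y.

(** On rectangles both image measures are products of the law [Q] of [hc], by independence on one
    side and by construction on the other; uniqueness of product measures extends this to all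
    sets. *)
Let joint (B : set (M2 * M2)) : measurable B ->
  P ((fun w => (X w, Y w)) @^-1` B) =
  (mua \x mua)%E ((fun z => (hc z.1, hc z.2)) @^-1` B).
Proof.
move=> mB.
pose hm : {mfun _ >-> M2} := HB.pack hc (isMeasurableFun.Build _ _ _ _ hc mhc).
pose Q := distribution mua hm.
have mXY : measurable_fun setT (fun w => (X w, Y w) : M2 * M2).
  exact: measurable_fun_pair.
have mHH : measurable_fun setT (fun z : beta.+1.-tuple R * beta.+1.-tuple R =>
    (hc z.1, hc z.2) : M2 * M2).
  apply: measurable_fun_pair.
    exact: (measurableT_comp mhc measurable_fst).
  exact: (measurableT_comp mhc measurable_snd).
have mV (E : set M2) : measurable E -> measurable (hc @^-1` E).
  by move=> mE; rewrite -[X in measurable X]setTI; exact: mhc.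
have e1 := @product_measure_unique _ _ _ _ R Q Q (pushforward P (fun w => (X w, Y w) : M2 * M2)).
have e2 := @product_measure_unique _ _ _ _ R Q Q
  (pushforward (mua \x mua)%E (fun z => (hc z.1, hc z.2) : M2 * M2)).
rewrite -[LHS]e1//; last first.
  move=> E F mE mF; transitivity (P (X @^-1` E `&` Y @^-1` F)); first by [].
  by rewrite XY// lawX// lawY.
rewrite -[RHS]e2// => E F mE mF.
transitivity ((mua \x mua)%E (hc @^-1` E `*` hc @^-1` F)); first by [].
by rewrite product_measure1E//; exact: mV.
Qed.

Let integrable_sqdist (a b e : R) : `|e| <= 1 ->
  (mua \x mua)%E.-integrable setT (EFin \o (fun z => a * sqdist e z + b)).
Proof.
move=> e1; have [r [r0 _ lE]] := is_mu_alpha_box beta0 mualpha.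
have s1 : subexponential (cst 1 : beta.+1.-tuple R -> R) by exact: subexponential_cst.
apply: eq_integrable (integrable_subexponential0 (exp_integrable_sqdist r0 lE a b e1) s1) => //.
by move=> z _; rewrite /= mulr1.
Qed.

(** Both random matrices become real multiples of the identity, so the scalar identity
    [sqdist_conditional] suffices. Scaling by [c] multiplies [C] by [c^2] and leaves [A] unchanged,
    the relation being quadratic. *)
Theorem cond_expectation_hyperbolic : cond_expectation P
  (fun w => sqmx (X w - Y w)) (fun w => X w + Y w)
  (fun w => qreal A *: sqmx (X w + Y w) + (qreal (c ^+ 2 * C))%:M).
Proof.
have n1 : `|-1| <= 1 :> R by rewrite normrN normr1.
have n2 : `|1| <= 1 :> R by rewrite normr1.
pose p1 w : M2 * M2 := (X w, Y w).
pose p2 (z : beta.+1.-tuple R * beta.+1.-tuple R) : M2 * M2 := (hc z.1, hc z.2).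
have mp1 : measurable_fun setT p1 by exact: measurable_fun_pair.
have mp2 : measurable_fun setT p2.
  apply: measurable_fun_pair.
    exact: (measurableT_comp mhc measurable_fst).
  exact: (measurableT_comp mhc measurable_snd).
pose fZ i j k (p : M2 * M2) : R := mxcoord i j k (sqmx (p.1 - p.2)).
pose fW i j k (p : M2 * M2) : R :=
  mxcoord i j k (qreal A *: sqmx (p.1 + p.2) + (qreal (c ^+ 2 * C))%:M).
have mfst : measurable_fun setT (fun p : M2 * M2 => p.1) by exact: measurable_fst.
have msnd : measurable_fun setT (fun p : M2 * M2 => p.2) by exact: measurable_snd.
have madd : measurable_fun setT (fun p : M2 * M2 => p.1 + p.2) by exact: measurable_mxD.
have mfZ i j k : measurable_fun setT (fZ i j k).
  apply: measurable_mxcoord.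
  have msub : measurable_fun setT (fun p : M2 * M2 => p.1 - p.2).
    under eq_fun do rewrite -scaleN1r.
    by apply: measurable_mxD => //; exact: measurable_mxZ.
  exact: measurable_mxM.
have mfW i j k : measurable_fun setT (fW i j k).
  apply: measurable_mxcoord; apply: measurable_mxD => //.
  by apply: measurable_mxZ; exact: measurable_mxM.
pose u := @sqdist R beta.+1 (-1).
pose v z := A * @sqdist R beta.+1 1 z + C.
have fZE i j k z : fZ i j k (p2 z) = c ^+ 2 * scalar_coord i j k * u z.
  case: z => x y; rewrite /fZ /p2 /=.
  have -> : hc x - hc y = hc (tuple_comb (-1) x y).
    by rewrite hc_comb (_ : qreal (-1) = -1) ?scaleN1r//; apply: quat_ext; rewrite /= ?oppr0.
  by rewrite sqmx_scale mxcoord_scalar -sqdistE mulrAC.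
have hcD x y : hc x + hc y = hc (tuple_add x y).
  by rewrite tuple_addE hc_comb (_ : qreal 1 = 1)// scale1r.
have fWE i j k z : fW i j k (p2 z) = c ^+ 2 * scalar_coord i j k * v z.
  case: z => x y; rewrite /fW /p2 /= hcD sqmx_scale scale_scalar_mx -qrealM.
  rewrite -raddfD /= -qrealD mxcoord_scalar tuple_addE -sqdistE /v.
  by ring.
have iu : (mua \x mua)%E.-integrable setT (EFin \o u).
  apply: eq_integrable (integrable_sqdist 1 0 n1) => // z _.
  by rewrite /= mul1r addr0.
have iv : (mua \x mua)%E.-integrable setT (EFin \o v) by exact: integrable_sqdist.
have iZ i j k : (mua \x mua)%E.-integrable setT (fun z => (fZ i j k (p2 z))%:E).
  under eq_fun do rewrite fZE.
  exact: (integrableZl measurableT (c ^+ 2 * scalar_coord i j k) iu).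
have iW i j k : (mua \x mua)%E.-integrable setT (fun z => (fW i j k (p2 z))%:E).
  under eq_fun do rewrite fWE.
  exact: (integrableZl measurableT (c ^+ 2 * scalar_coord i j k) iv).
split.
- by move=> i j k; exact: (integrable_same_image mp1 mp2 joint (mfZ i j k) (iZ i j k)).
- by move=> i j k; exact: (integrable_same_image mp1 mp2 joint (mfW i j k) (iW i j k)).
(* [T'] is [T] with the sigma-algebra generated by [S], for which [S] is measurable by
   construction. *)
- pose S : T -> M2 := fun w => X w + Y w.
  pose T' := g_sigma_algebra_preimageType S.
  have mS : measurable_fun [set: T'] S.
    by move=> _ B mB; rewrite setTI; exists B => //; rewrite setTI.
  apply: (@measurable_mxD R _ T'); last exact: measurable_cst.
  by apply: (@measurable_mxZ R _ T'); exact: (@measurable_mxM R _ T').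
- move=> E mE i j k; pose D := (fun p : M2 * M2 => p.1 + p.2) @^-1` E.
  have mD : measurable D by rewrite -[X in measurable X]setTI; exact: madd.
  rewrite [LHS](integral_same_image mp1 mp2 joint (mfZ i j k) (iZ i j k) mD).
  rewrite [RHS](integral_same_image mp1 mp2 joint (mfW i j k) (iW i j k) mD).
  have mhE : measurable (hc @^-1` E) by rewrite -[X in measurable X]setTI; exact: mhc.
  (* Conditioning on the sum of the matrices amounts to conditioning on the sum of the coordinate
     vectors, since [hc] is additive. *)
  have -> : p2 @^-1` D = (fun z => tuple_add z.1 z.2) @^-1` (hc @^-1` E).
    by apply/seteqP; split=> z; rewrite /D /p2 /= hcD.
  set D' := _ @^-1` _.
  have mD' : measurable D'.
    by rewrite -[X in measurable X]setTI; exact: measurable_tuple_add.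
  have iu' : (mua \x mua)%E.-integrable D' (EFin \o u).
    exact: (integrableS measurableT mD' _ iu).
  have iv' : (mua \x mua)%E.-integrable D' (EFin \o v).
    exact: (integrableS measurableT mD' _ iv).
  under eq_integral do rewrite fZE EFinM.
  under [RHS]eq_integral do rewrite fWE EFinM.
  rewrite !integralZl//; congr (_ * _)%E.
  rewrite -[LHS]fineK ?(integrable_fin_num mD' iu')//.
  rewrite -[RHS]fineK ?(integrable_fin_num mD' iv')//; congr EFin.
  have [r [r0 sg lE]] := is_mu_alpha_box beta0 mualpha.
  exact: (sqdist_conditional nuE nu0 alpha0 r0 sg lE mhE).
Qed.

End hyperbolic_law.

(** * Meixner property, moments and standardization of the ensemble *)

Section standardized_ensemble.
Context {R : realType}.
Variables (beta : nat) (alpha : R) (mu : probability 'M[quat R]_2 R).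
Hypotheses (hbeta : beta \in [:: 1; 2; 4]%N) (alpha0 : 0 < alpha).
Variable mua : probability (beta.+1.-tuple R) R.
Hypothesis mualpha : is_mu_alpha alpha mua.
Hypothesis muE : forall E, measurable E -> mu E = mua (@hyperbolic_mx R beta @^-1` E).
Notation hyp := (@hyperbolic_mx R beta).

Let mhyp : measurable_fun setT hyp.
Proof. exact: measurable_hyperbolic_mx. Qed.

Lemma exceptional_hyperbolic_meixner :
  meixner_ensemble beta (1 / (1 + 2 * alpha)) 0
    (4 * alpha ^+ 2 / (2 * alpha + 1)) mu.
Proof.
split.
- rewrite muE; last exact: measurable_hermitian.
  rewrite (_ : _ @^-1` _ = setT); first exact: probability_setT.
  by apply/seteqP; split=> // x _; exact: hermitian_hyperbolic.
- move=> U uU E mE.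
  have mUMU : measurable_fun setT (fun M : 'M[quat R]_2 => U *m M *m adjoint U).
    by apply: measurable_mxM => //; apply: measurable_mxM.
  rewrite !muE//; last by rewrite -[X in measurable X]setTI; exact: mUMU.
  rewrite -[RHS](hyperbolic_rotation hbeta mualpha uU); last first.
    by rewrite -[X in measurable X]setTI; exact: mhyp.
  congr (mua _); apply/seteqP.
  by split=> x; rewrite /= hyperbolic_mx_conj.
- move=> i j k.
  have msq : measurable_fun setT (fun M : 'M[quat R]_2 => mxcoord i j k M ^+ 2).
    by apply: measurable_funX; exact: measurable_mxcoord.
  apply: (integrable_same_image (m2 := mua) (phi1 := id) (phi2 := hyp) _ _ _ msq) => //.
  apply: (hyperbolic_subexponential_integrable hbeta mualpha
    (g := fun x => mxcoord i j k (hyp x) ^+ 2)).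
  by apply: subexponentialM; exact: subexponential_mxcoord.
- move=> d T P X Y lX lY XY /=.
  have law (Z : {RV P >-> 'M[quat R]_2}) : has_law Z mu -> forall E, measurable E ->
      P (Z @^-1` E) = mua ((fun x => qreal 1 *: hyp x) @^-1` E).
    move=> lZ E mE; transitivity (mu E); first exact: lZ.
    rewrite muE//; congr (mua _).
    by apply/seteqP; split=> x /=; rewrite (_ : qreal 1 = 1)// scale1r.
  have := cond_expectation_hyperbolic hbeta alpha0 mualpha
    (measurable_funPT X) (measurable_funPT Y) (law _ lX) (law _ lY) XY.
  rewrite expr1n; congr cond_expectation.
  by apply/funext => w; rewrite !mul1r (_ : qreal 0 = 0)// scale0r addr0.
Qed.

Section moments.
Context {d} {T : measurableType d} (P : probability T R) (X : {RV P >-> 'M[quat R]_2}).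
Hypothesis lX : has_law X mu.

Lemma expectation_law (f : 'M[quat R]_2 -> R) : measurable_fun setT f ->
  mua.-integrable setT (fun x => (f (hyp x))%:E) ->
  fine 'E_P[fun w => f (X w)]%E = \int[mua]_x f (hyp x).
Proof.
move=> mf i2; rewrite unlock; congr fine.
apply: (integral_same_image (measurable_funPT X) mhyp _ mf i2 measurableT).
by move=> A mA; transitivity (mu A); [exact: lX|exact: muE].
Qed.

Lemma mx_expectation_law (F : 'M[quat R]_2 -> 'M[quat R]_2) (a : 'I_2 -> 'I_2 -> 'I_4 -> R) :
  (forall i j k, measurable_fun setT (fun M => mxcoord i j k (F M))) ->
  (forall i j k, mua.-integrable setT (fun x => (mxcoord i j k (F (hyp x)))%:E)) ->
  (forall i j k, \int[mua]_x mxcoord i j k (F (hyp x)) = a i j k) ->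
  forall i j k, mxcoord i j k (mx_expectation P (fun w => F (X w))) = a i j k.
Proof.
move=> mF iF aE i j k; rewrite -aE -[RHS](expectation_law (mF i j k) (iF i j k)).
rewrite /mxcoord /qcoord mxE.
by case: k => [[|[|[|[|k]]]] hk].
Qed.

Lemma mxcoordP (M N : 'M[quat R]_2) :
  (forall i j k, mxcoord i j k M = mxcoord i j k N) -> M = N.
Proof.
move=> e; apply/matrixP => i j; apply: quat_ext.
- exact: (e i j (@Ordinal 4 0 isT)).
- exact: (e i j (@Ordinal 4 1 isT)).
- exact: (e i j (@Ordinal 4 2 isT)).
- exact: (e i j (@Ordinal 4 3 isT)).
Qed.

Lemma mx_expectation_hyperbolic : mx_expectation P X = 0.
Proof.
apply: mxcoordP => i j k.
have -> : mxcoord i j k (0 : 'M[quat R]_2) = 0.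
  by rewrite /mxcoord mxE /qcoord; case: k => [[|[|[|[|k]]]] hk].
apply: (mx_expectation_law (F := id) (a := fun _ _ _ => 0)) => {i j k} i j k.
- exact: measurable_mxcoord.
- exact: (hyperbolic_subexponential_integrable hbeta mualpha (subexponential_mxcoord _ i j k)).
- exact: (mean_mxcoord hbeta mualpha).
Qed.

(** The mean vanishes and the matrix square is [|xi|^2] times the identity, so only the second
    moment of [mua] remains. *)
Lemma mx_variance_hyperbolic : mx_variance P X = (qreal alpha)%:M.
Proof.
rewrite /mx_variance mx_expectation_hyperbolic /sqmx mulmx0 subr0.
apply: mxcoordP => i j k; rewrite mxcoord_scalar.
have sdot : subexponential (fun x : beta.+1.-tuple R => dot x x).
  pose q l : beta.+1.-tuple R -> R := (fun x => x`_l) \* (fun x => x`_l).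
  have sq l : subexponential (q l) by apply: subexponentialM; exact: subexponential_nth.
  rewrite (_ : (fun x => dot x x) = q 0 \+ q 1 \+ q 2 \+ q 3 \+ q 4)%N.
    by do 4 apply: subexponentialD => //.
  by apply/funext => x; rewrite dot_nthE.
have idot := hyperbolic_subexponential_integrable hbeta mualpha sdot.
have cE i' j' k' x : mxcoord i' j' k' (sqmx (hyp x)) = dot x x * scalar_coord i' j' k'.
  by rewrite sqmx_hyperbolic// mxcoord_scalar.
apply: (mx_expectation_law (F := @sqmx R)
  (a := fun i j k => alpha * scalar_coord i j k)) => {i j k} i j k.
- by apply: measurable_mxcoord; exact: measurable_mxM.
- under eq_fun do rewrite cE mulrC.
  exact: (integrableZl measurableT (scalar_coord i j k) idot).
- under eq_Rintegral do rewrite cE.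
  by rewrite (RintegralZr _ _ idot)// (hyperbolic_second_moment hbeta alpha0 mualpha).
Qed.

(** The scale is [c = 1 / s]. For [a = 1 / (4 alpha)] one has
    [2 / (1 + 2 a) = 4 alpha / (2 alpha + 1)], which is [C / s^2], and [a] times this value is
    [A]. *)
Lemma standardized_cond_expectation (s : R) : 0 < s -> s ^+ 2 = alpha ->
  let Xt := standardize 0 s X in
  forall Yt : {RV P >-> 'M[quat R]_2}, same_law P Xt Yt -> independent P Xt Yt ->
  let St := fun w => Xt w + Yt w in
  let a := 1 / (4 * alpha) in
  cond_expectation P (fun w => sqmx (Xt w - Yt w)) St
    (fun w => qreal (2 / (1 + 2 * a)) *:
       (1%:M + qreal 0 *: St w + qreal a *: sqmx (St w))).
Proof.
move=> s0 sa Xt Yt XtYt ind St a.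
have XtE w : Xt w = qreal s^-1 *: X w.
  rewrite /Xt /standardize (_ : (qreal 0)%:M = 0) ?subr0//.
  by apply/matrixP => i j; rewrite !mxE (_ : qreal 0 = 0)// mul0rn.
have mXt : measurable_fun setT Xt.
  by rewrite (funext XtE); exact: measurable_mxZ.
have lXt E : measurable E -> P (Xt @^-1` E) = mua ((fun x => qreal s^-1 *: hyp x) @^-1` E).
  move=> mE; pose E' := (fun M : 'M[quat R]_2 => qreal s^-1 *: M) @^-1` E.
  have mE' : measurable E'.
    rewrite -[X in measurable X]setTI.
    by apply: (measurable_mxZ (qreal s^-1) (f := id)).
  transitivity (P (X @^-1` E')).
    by congr (P _); apply/seteqP; split=> w; rewrite /= XtE.
  by transitivity (mu E'); [exact: lX|rewrite muE].
have lYt E : measurable E -> P (Yt @^-1` E) = mua ((fun x => qreal s^-1 *: hyp x) @^-1` E).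
  by move=> mE; rewrite -XtYt// lXt.
have := cond_expectation_hyperbolic hbeta alpha0 mualpha mXt (measurable_funPT Yt) lXt lYt ind.
congr cond_expectation; apply/funext => w.
rewrite (_ : qreal 0 = 0)// scale0r addr0 scalerDr scalerA -qrealM addrC.
have a0 := alpha0.
congr (_ + qreal _ *: _); last first.
  by rewrite /a; field; do ?[apply/andP; split]; rewrite gt_eqF//; lra.
rewrite scale_scalar_mx mulr1 exprVn sa; congr (qreal _)%:M.
by rewrite /a; field; do ?[apply/andP; split]; rewrite gt_eqF//; lra.
Qed.

End moments.

End standardized_ensemble.

Theorem proposition3p12 (R : realType) (beta : nat) (alpha : R)
    (mu : probability 'M[quat R]_2 R)
    (hbeta : beta \in [:: 1; 2; 4]%N) (halpha : 0 < alpha)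
    (hmu : exceptional_hyperbolic beta alpha mu) :
  meixner_ensemble beta (1 / (1 + 2 * alpha)) 0
    (4 * alpha ^+ 2 / (2 * alpha + 1)) mu /\
  forall (d : measure_display) (T : measurableType d) (P : probability T R)
      (X : {RV P >-> 'M[quat R]_2}), has_law X mu ->
    [/\ mx_expectation P X = 0,
        mx_variance P X = (qreal alpha)%:M
      & forall m s : R, 0 < s ->
          mx_expectation P X = (qreal m)%:M ->
          mx_variance P X = (qreal (s ^+ 2))%:M ->
          let Xt := standardize m s X in
          forall Yt : {RV P >-> 'M[quat R]_2},
            same_law P Xt Yt -> independent P Xt Yt ->
            let St := fun w => Xt w + Yt w in
            let a := 1 / (4 * alpha) in
            let b : R := 0 in
            cond_expectation P
              (fun w => sqmx (Xt w - Yt w))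
              St
              (fun w => qreal (2 / (1 + 2 * a)) *:
                 (1%:M + qreal b *: St w + qreal a *: sqmx (St w)))].
Proof.
have [mua mualpha muE] := hmu.
split; first exact: exceptional_hyperbolic_meixner muE.
move=> d T P X lX.
have EX := mx_expectation_hyperbolic hbeta mualpha muE lX.
have VX := mx_variance_hyperbolic hbeta halpha mualpha muE lX.
split=> // m s s0; rewrite EX VX => Em Vs.
(* The entries (0, 0) of the mean and variance equations determine [m] and [s ^+ 2]. *)
have m0 : m = 0.
  by move/matrixP/(_ 0 0): Em; rewrite !mxE /= mulr1n => -[].
have sa : s ^+ 2 = alpha.
  by move/matrixP/(_ 0 0): Vs; rewrite !mxE /= !mulr1n => -[].
rewrite m0; exact: (standardized_cond_expectation hbeta halpha mualpha muE lX s0 sa).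
Qed.
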